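(* Assume that the observations have a changepoint $\tau_n$ with $\tau_n/n\to\lambda\in(0,1)$ and fixed pre- and post-change parameters $\theta_0\neq\theta_1$, that conditions A'1--A'4 given in the context hold, and that $S_1^*\neq0$. Use the thresholds $$H_{\mathrm{lin}}(\alpha)=q_{\chi^2_d}\!\left(\frac{\alpha}{n}\right),\qquad H_p(\alpha)=q_{\chi^2_p}\!\left(\frac{\alpha}{\binom{d}{p}\,n\,(p+1)^2}\right),\quad p\in\{1,\dots,P\}.$$ Then the three tests $\psi_{\mathrm{auto}},\psi_{\mathrm{lin}},\psi_{\mathrm{scan}}$ are consistent in power: for every $\alpha\in(0,1)$, $$\mathbb P(\psi_{\mathrm{lin}}(\alpha)=1)\to1,\qquad \mathbb P(\psi_{\mathrm{scan}}(\alpha)=1)\to1,\qquad \mathbb P(\psi_{\mathrm{auto}}(\alpha)=1)\to1\qquad(n\to\infty).$$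
   Context: Setting. $\{p_\theta:\theta\in\Theta\subset\mathbb R^d\}$ is a family of density functions; for each $n$, $W_1,\dots,W_n$ are independent with $W_1,\dots,W_{\tau_n}\sim p_{\theta_0}$ and $W_{\tau_n+1},\dots,W_n\sim p_{\theta_1}$, $\tau_n\in\{1,\dots,n-1\}$. Write $\bar\lambda=1-\lambda$, $\ell(\theta)=\ell(\theta\mid x)=\log p_\theta(x)$, and $\mathbb E_{\theta_l}$ for expectation under $W\sim p_{\theta_l}$. Conditions. A'1: $F(\theta)=\lambda D_{\mathrm{KL}}(p_{\theta_0}\Vert p_\theta)+\bar\lambda D_{\mathrm{KL}}(p_{\theta_1}\Vert p_\theta)$ has a minimizer $\theta^*$ in the interior of $\Theta$ ($D_{\mathrm{KL}}$ is the Kullback--Leibler divergence). A'2: $\Theta$ contains an open neighborhood $\Theta^*$ of $\theta^*$ on which (a) $\ell(\theta\mid x)$ is twice continuously differentiable in $\theta$ almost surely; (b) the third partial derivatives $\nabla^3_{ijk}\ell(\theta\mid x)$ exist and satisfy $|\nabla^3_{ijk}\ell(\theta\mid x)|\le M_{ijk}(x)$ for $\theta\in\Theta^*$ and all $i,j,k\in\{1,\dots,d\}$, almost surely, with $\mathbb E_{\theta_l}M_{ijk}(W)<\infty$ for $l\in\{0,1\}$. A'3: $\mathbb E_{\theta_l}[\nabla_\theta\ell(\theta^* )]=\nabla_\theta\mathbb E_{\theta_l}[\ell(\theta)]|_{\theta=\theta^*}=:S_l^*$ for $l\in\{0,1\}$. A'4: $\mathcal I_l^*:=\mathbb E_{\theta_l}[-\nabla^2_\theta\ell(\theta^*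 )]$ is positive definite for $l\in\{0,1\}$. Statistics. $\ell_{s:t}(\theta)=\sum_{k=s}^t\log p_\theta(W_k)$, $S_{s:t}=\nabla_\theta\ell_{s:t}$, $\mathcal I_{s:t}=-\nabla^2_\theta\ell_{s:t}$. $\hat\theta_n$ is a sequence of MLEs, understood as solutions of the likelihood equation $\nabla_\theta\ell_{1:n}(\theta)=0$ (existing with probability tending to one), namely at each $n$ the solution closest to $\theta^*$, which satisfies $\hat\theta_n\to\theta^*$ in probability. For $\tau\in\{1,\dots,n-1\}$, $$\mathcal I_n(\theta;\tau)=\mathcal I_{\tau+1:n}(\theta)-\mathcal I_{\tau+1:n}(\theta)^\top\mathcal I_{1:n}(\theta)^{-1}\mathcal I_{\tau+1:n}(\theta).$$ For a vector $v$, matrix $A$ and $T\subset\{1,\dots,d\}$, $v_T$ and $A_{T,T}$ are the subvector and submatrix indexed by $T$. Define $$R_n(\tau)=S_{\tau+1:n}(\hat\theta_n)^\top\,\mathcal I_n(\hat\theta_n;\tau)^{-1}S_{\tau+1:n}(\hat\theta_n),\qquad R_n(\tau,T)=S_{\tau+1:n}(\hat\theta_n)_T^\top\,\big[\mathcal I_n(\hat\theta_n;\tau)_{T,T}\big]^{-1}S_{\tau+1:n}(\hat\theta_n)_T$$ (the inverses appearing are implicitly assumed to exist). Tests. $P\in\{1,\dots,d\}$ is fixed; $\mathcal T_p$ is the set of subsets of $\{1,\dots,d\}$ of size $p$; $q_D(\beta)$ is the upper $\beta$-quantile of $D$. $\psi_{\mathrm{lin}}(\alpha)=\mathbf 1\{\max_{1\le\tau\le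 n-1}R_n(\tau)>H_{\mathrm{lin}}(\alpha)\}$; $\psi_{\mathrm{scan}}(\alpha)=\mathbf 1\{\max_{1\le\tau\le n-1}\max_{1\le p\le P}\max_{T\in\mathcal T_p}H_p(\alpha)^{-1}R_n(\tau,T)>1\}$; $\psi_{\mathrm{auto}}(\alpha)=\max\{\psi_{\mathrm{lin}}(\alpha_l),\psi_{\mathrm{scan}}(\alpha_s)\}$ with $\alpha_l,\alpha_s\ge0$, $\alpha_l+\alpha_s=\alpha$ (a test at level $0$ never rejects). *)

(* Defs.v *)
From HB Require Import structures.
From mathcomp Require Import all_boot all_order all_algebra.
From mathcomp Require Import all_classical all_reals all_analysis.

Set Implicit Arguments.
Unset Strict Implicit.
Unset Printing Implicit Defensive.

Import Order.TTheory GRing.Theory Num.Theory.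
Import numFieldNormedType.Exports.

Local Open Scope classical_set_scope.
Local Open Scope ring_scope.

(* The log-likelihood is not assumed to be measurable in the observation at
   every parameter, so neither need be the events built from an estimator.
   Limits of their probabilities are limits of inner probabilities, which
   agree with P on measurable events (inner_prob_measurable). *)
Definition inner_prob (R : realType) (d : measure_display)
    (T : measurableType d) (P : probability T R) (A : set T) : \bar R :=
  ereal_sup [set P E | E in [set E | measurable E /\ E `<=` A]].

Lemma inner_prob_measurable (R : realType) (d : measure_display)
    (T : measurableType d) (P : probability T R) (A : set T) :
  measurable A -> inner_prob P A = P A.
Proof.
move=> mA; apply/eqP; rewrite eq_le; apply/andP; split.
  apply: ge_ereal_sup => _ [E [mE EA] <-].
  by apply: le_measure => //; rewrite inE.
by apply: ereal_sup_ubound; exists A => //; split.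
Qed.

Section chi_square.
Variable R : realType.

Definition Gamma (a : R) : R :=
  \int[lebesgue_measure]_(x in `]0, +oo[) (x `^ (a - 1) * expR (- x)).

Definition chi2_pdf (k : nat) (x : R) : R :=
  if 0 < x then
    x `^ (k%:R / 2 - 1) * expR (- x / 2) / (2 `^ (k%:R / 2) * Gamma (k%:R / 2))
  else 0.

Definition chi2 (k : nat) (A : set R) : \bar R :=
  (\int[lebesgue_measure]_(x in A) (chi2_pdf k x)%:E)%E.

(* Used for 0 < beta < 1 only; the infimum is a junk value at beta = 0. *)
Definition upper_quantile (D : set R -> \bar R) (beta : R) : R :=
  inf [set t : R | (D `]t, +oo[%classic <= beta%:E)%E].

End chi_square.

Section calculus.
Variables (R : realType) (d : nat).
Implicit Types (f : 'cV[R]_d -> R) (A : set 'cV[R]_d).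

(* The library norm on matrices is the sup norm. *)
Definition enorm (v : 'cV[R]_d) : R := Num.sqrt (\sum_i (v i 0) ^+ 2).

Definition basis_vec (i : 'I_d) : 'cV[R]_d := delta_mx i 0.

Definition partial (i : 'I_d) f : 'cV[R]_d -> R := 'D_(basis_vec i) f.

Definition grad f (theta : 'cV[R]_d) : 'cV[R]_d := \col_i partial i f theta.

Definition hess f (theta : 'cV[R]_d) : 'M[R]_d :=
  \matrix_(i, j) partial i (partial j f) theta.

Definition C2_on A f : Prop :=
  forall theta, A theta ->
    {for theta, continuous f} /\
    forall j, derivable f theta (basis_vec j) /\
      {for theta, continuous (partial j f)} /\
      forall i, derivable (partial j f) theta (basis_vec i) /\
        {for theta, continuous (partial i (partial j f))}.

Definition posdef (A : 'M[R]_d) : Prop :=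
  A^T = A /\ forall v : 'cV[R]_d, v != 0 -> 0 < (v^T *m A *m v) 0 0.

End calculus.

Section model.
Variables (R : realType) (d : nat) (dX : measure_display).
Variable (X : measurableType dX).
Variable mu : {measure set X -> \bar R}.
Variable Theta : set 'cV[R]_d.
Variable p : 'cV[R]_d -> X -> R.
Variable Pr : 'cV[R]_d -> probability X R.

Definition density_family : Prop :=
  forall theta, Theta theta ->
    measurable_fun [set: X] (p theta) /\ (forall x, 0 <= p theta x) /\
    forall A, measurable A -> Pr theta A = (\int[mu]_(x in A) (p theta x)%:E)%E.

Definition KL (f g : X -> R) : \bar R :=
  (\int[mu]_x (if (f x == 0)%R then 0
               else if (g x == 0)%R then +oo
               else (f x * ln (f x / g x))%:E))%E.

(* ln 0 = 0 in the library: wherever the derivatives of ell matter, the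
   density is required to be positive around the parameter. *)
Definition ell (x : X) (theta : 'cV[R]_d) : R := ln (p theta x).

Definition expect (theta : 'cV[R]_d) (g : X -> R) : R :=
  \int[Pr theta]_x g x.

Definition expect_finite (theta : 'cV[R]_d) (g : X -> R) : Prop :=
  (Pr theta).-integrable [set: X] (EFin \o g).

Definition Sstar (theta thetas : 'cV[R]_d) : 'cV[R]_d :=
  \col_i expect theta (fun x => partial i (ell x) thetas).

Definition Istar (theta thetas : 'cV[R]_d) : 'M[R]_d :=
  \matrix_(i, j) expect theta (fun x => - partial i (partial j (ell x)) thetas).

Section conditions.
Variables (lambda : R) (theta0 theta1 thetas : 'cV[R]_d).

Definition Fobj (theta : 'cV[R]_d) : \bar R :=
  (lambda%:E * KL (p theta0) (p theta) +
   (1 - lambda)%:E * KL (p theta1) (p theta))%E.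

Definition condA1 : Prop :=
  interior Theta thetas /\
  forall theta, Theta theta -> (Fobj thetas <= Fobj theta)%E.

(* Almost sure differentiability of log p presupposes p > 0 on Thetas, which
   has to be spelled out since ln is total. *)
Definition condA2 : Prop :=
  exists (Thetas : set 'cV[R]_d) (M : 'I_d -> 'I_d -> 'I_d -> X -> R),
    [/\ open Thetas, Thetas thetas, Thetas `<=` Theta
      & forall th, [set theta0; theta1] th ->
        [/\ {ae Pr th, forall x,
              (forall theta, Thetas theta -> 0 < p theta x) /\
              C2_on Thetas (ell x)},
            {ae Pr th, forall x, forall theta, Thetas theta ->
              forall i j k,
                derivable (partial j (partial k (ell x))) theta
                          (basis_vec R i) /\
                `|partial i (partial j (partial k (ell x))) theta|
                  <= M i j k x}
          & forall i j k, expect_finite th (M i j k)]].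

(* The existence of the expectations, and of the gradient on the right-hand
   side, is part of the condition since integrals and derivatives are total. *)
Definition condA3 : Prop :=
  forall th, [set theta0; theta1] th ->
    (\forall theta \near thetas, expect_finite th (ell^~ theta)) /\
    forall i,
      [/\ expect_finite th (fun x => partial i (ell x) thetas),
          derivable (fun theta => expect th (ell^~ theta)) thetas
                    (basis_vec R i)
        & expect th (fun x => partial i (ell x) thetas) =
          partial i (fun theta => expect th (ell^~ theta)) thetas].

Definition condA4 : Prop :=
  forall th, [set theta0; theta1] th ->
    (forall i j,
      expect_finite th (fun x => partial i (partial j (ell x)) thetas)) /\
    posdef (Istar th thetas).

End conditions.

Section sample.
Variable w : nat -> X.

(* Observations are numbered from 1. *)
Definition loglik (s t : nat) (theta : 'cV[R]_d) : R :=
  \sum_(s <= k < t.+1) ell (w k) theta.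

Definition score (s t : nat) (theta : 'cV[R]_d) : 'cV[R]_d :=
  grad (loglik s t) theta.

Definition info (s t : nat) (theta : 'cV[R]_d) : 'M[R]_d :=
  - hess (loglik s t) theta.

Definition info_cp (n tau : nat) (theta : 'cV[R]_d) : 'M[R]_d :=
  info tau.+1 n theta -
  (info tau.+1 n theta)^T *m invmx (info 1 n theta) *m info tau.+1 n theta.

(* A solution lies in the interior of Theta and the log-likelihood is finite
   around it, so that its gradient is meaningful there. *)
Definition likelihood_root (n : nat) (theta : 'cV[R]_d) : Prop :=
  (\forall t \near theta,
     Theta t /\ forall k, (1 <= k <= n)%N -> 0 < p t (w k)) /\
  (forall i, derivable (loglik 1 n) theta (basis_vec R i)) /\
  score 1 n theta = 0.

Definition closest_root (n : nat) (thetas theta : 'cV[R]_d) : Prop :=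
  likelihood_root n theta /\
  forall t, likelihood_root n t -> enorm (theta - thetas) <= enorm (t - thetas).

(* invmx A is A itself when A is singular, so the statistics below are total;
   no invertibility is assumed anywhere. *)
Definition Rstat (n tau : nat) (theta : 'cV[R]_d) : R :=
  ((score tau.+1 n theta)^T *m invmx (info_cp n tau theta) *m
   score tau.+1 n theta) 0 0.

Definition subvec (T : {set 'I_d}) (v : 'cV[R]_d) : 'cV[R]_#|T| :=
  rowsub (fun i : 'I_#|T| => enum_val i) v.

Definition submat (T : {set 'I_d}) (A : 'M[R]_d) : 'M[R]_#|T| :=
  mxsub (fun i : 'I_#|T| => enum_val i) (fun i : 'I_#|T| => enum_val i) A.

Definition RstatT (n tau : nat) (T : {set 'I_d}) (theta : 'cV[R]_d) : R :=
  ((subvec T (score tau.+1 n theta))^T *m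
   invmx (submat T (info_cp n tau theta)) *m
   subvec T (score tau.+1 n theta)) 0 0.

Definition Hlin (n : nat) (alpha : R) : R :=
  upper_quantile (@chi2 R d) (alpha / n%:R).

Definition Hscan (n q : nat) (alpha : R) : R :=
  upper_quantile (@chi2 R q)
    (alpha / ('C(d, q)%:R * n%:R * (q.+1)%:R ^+ 2)).

(* The tests return true when they reject, which never happens at level 0.
   Maxima are in the extended reals so as not to be clipped by a real default
   value. *)
Definition psi_lin (n : nat) (theta : 'cV[R]_d) (alpha : R) : bool :=
  (0 < alpha) &&
  ((Hlin n alpha)%:E <
     \big[maxe/-oo]_(1 <= tau < n) (Rstat n tau theta)%:E)%E.

Definition psi_scan (pmax n : nat) (theta : 'cV[R]_d) (alpha : R) : bool :=
  (0 < alpha) &&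
  (1 < \big[maxe/-oo]_(1 <= tau < n) \big[maxe/-oo]_(1 <= q < pmax.+1)
         \big[maxe/-oo]_(T : {set 'I_d} | #|T| == q)
           ((Hscan n q alpha)^-1 * RstatT n tau T theta)%:E)%E.

Definition psi_auto (pmax n : nat) (theta : 'cV[R]_d) (alphal alphas : R)
    : bool :=
  psi_lin n theta alphal || psi_scan pmax n theta alphas.

End sample.

Section data.
Variables (dO : measure_display) (Omega : measurableType dO).
Variable P : probability Omega R.
Variable W : nat -> nat -> {RV P >-> X}.

Definition independent_sample (n : nat) : Prop :=
  forall A : nat -> set X, (forall k, measurable (A k)) ->
    P (\bigcap_(k in [set k | (1 <= k <= n)%N]) (W n k @^-1` A k)) =
    (\prod_(1 <= k < n.+1) P (W n k @^-1` A k))%E.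

Definition changepoint_data (tau : nat -> nat) (theta0 theta1 : 'cV[R]_d)
    : Prop :=
  forall n, (2 <= n)%N ->
    [/\ (1 <= tau n <= n.-1)%N,
        independent_sample n,
        (forall k, (1 <= k <= tau n)%N -> forall A, measurable A ->
           distribution P (W n k) A = Pr theta0 A)
      & (forall k, (tau n < k <= n)%N -> forall A, measurable A ->
           distribution P (W n k) A = Pr theta1 A)].

Definition mle_sequence (thetas : 'cV[R]_d)
    (thetahat : nat -> Omega -> 'cV[R]_d) : Prop :=
  (inner_prob P [set w | closest_root (fun k => W n k w) n thetas
                           (thetahat n w)] @[n --> \oo] --> 1%E) /\
  forall e : R, 0 < e ->
    inner_prob P [set w | enorm (thetahat n w - thetas) < e]
      @[n --> \oo] --> 1%E.

End data.

End model.

(* Main.v *)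
(* At the true changepoint, a Taylor expansion around [thetas] at the consistent
   estimator, with averages controlled by a weak law of large numbers for
   integrable variables, shows that the score and the information matrices
   divided by [n] converge to [(1 - lambda) S1], [(1 - lambda) I1] and
   [lambda I0 + (1 - lambda) I1].  Hence the statistics are at least [c n] with
   inner probability tending to one, where [c] is positive because [S1 <> 0] and
   the limit of the profile information is the parallel sum of two positive
   definite matrices.  The chi-square thresholds are [o(n)]: the tail at [t] is
   [O(t^-2)], so the upper quantile at level [b / n] is [O(sqrt n)]. *)
Require Import Defs.
From HB Require Import structures.
From mathcomp Require Import all_boot all_order all_algebra.
From mathcomp Require Import all_classical all_reals all_analysis.
From mathcomp Require Import measurable_realfun ring lra.
Set Implicit Arguments.
Unset Strict Implicit.
Unset Printing Implicit Defensive.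
Import Order.TTheory GRing.Theory Num.Theory.
Import numFieldNormedType.Exports.
Local Open Scope classical_set_scope.
Local Open Scope ring_scope.

(** * Tails and quantiles of the chi-square distribution *)

(** The estimator need not be measurable, so everything about it is reduced to deterministic
    inequalities. On a sample whose averages at the fixed point [thetas] are close to their limits,
    and whose estimator lies near [thetas], every bound holds pointwise. Such samples contain a
    measurable event of large probability, which is all that an inner probability asks for.

    The envelopes of the third derivatives have a first moment only, so no variance bound applies to
    them directly. The rows [W n] also change with [n], so the law of large numbers has to be
    uniform over all samples of a given law.

    The statistics are homogeneous of degree one: dividing score and information by [n] divides the
    quadratic form by [n], whence the growth [c n]. A single estimate with a coordinate selection
    [f] serves both tests. The identity gives the linear statistic, and one index where [S_1^*] does
    not vanish gives a term of the scan with [p = 1]. For the combined test, at least one of the two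
    levels is positive. *)

Section chi_square_tails.
Context {R : realType}.
Local Notation leb := (@lebesgue_measure R).

Let mkern (c a : R) :
  measurable_fun [set: R] (fun x : R => x `^ a * expR (c * x)).
Proof.
apply: measurable_funM; first exact: measurable_powR.
by apply: measurableT_comp => //; exact: measurable_funM.
Qed.

(** After cancelling [expR (- (x / 2))], this is the comparison of [x ^+ k.+1] with [expR (x / 4)]
    through one term of the exponential series, which is where the constant comes from. The
    remaining factor is, up to normalization, an exponential density of rate [4^-1]. *)
Lemma powR_expR_le (k : nat) (a x : R) : a <= k%:R -> 1 <= x ->
  x `^ a * expR (- (2^-1 * x)) <=
    (4 ^+ k.+1 * (k.+1)`!%:R) * expR (- (4^-1 * x)).
Proof.
move=> ak x1.
have x0 : 0 <= x by exact: le_trans x1.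
have -> : - (2^-1 * x) = 4^-1 * x *- 2 :> R by lra.
have -> : - (4^-1 * x) = 4^-1 * x + 4^-1 * x *- 2 :> R by lra.
rewrite expRD mulrA ler_pM2r ?expR_gt0//.
apply: (@le_trans _ _ (x ^+ k.+1)).
  rewrite -powR_mulrn//; apply: ler_powR => //.
  by rewrite (le_trans ak)// ler_nat.
have := @expR_ge1Dxn R (4^-1 * x) k (mulr_ge0 _ x0).
rewrite invr_ge0 ler0n => /(_ isT); set F := (k.+1)`!%:R.
have F0 : 0 < F by rewrite ltr0n fact_gt0.
move=> h.
have {}h : (4^-1 * x) ^+ k.+1 / F <= expR (4^-1 * x) by lra.
rewrite ler_pdivrMr// exprMn in h.
rewrite exprVn in h.
rewrite -mulrA [F * _]mulrC.
by rewrite mulrC ler_pdivrMr ?exprn_gt0// mulrC in h.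
Qed.

(** For [a < 1] the integrand is unbounded at 0, so the interval is exhausted by compact ones, with
    an antiderivative on each and monotone convergence. Starting at [n.+2] keeps these intervals
    nondegenerate. *)
Lemma integral_powR_oc01_le (a : R) : 0 < a ->
  (\int[leb]_(x in `]0%R, 1%R]) (x `^ (a - 1))%:E <= (a^-1)%:E)%E.
Proof.
move=> a0.
have -> : `]0%R, 1%R]%classic = \bigcup_n `[n.+2%:R^-1 : R, 1%R]%classic.
  apply/seteqP; split => x /=.
    rewrite in_itv/= => /andP[x0 x1].
    exists (Num.truncn x^-1) => //=; rewrite in_itv/= x1 andbT.
    rewrite -[leRHS]invrK lef_pV2 ?posrE ?invr_gt0//.
    by rewrite (le_trans (ltW (truncnS_gt _)))// ler_nat.
  move=> [n _] /=; rewrite !in_itv/= => /andP[nx ->].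
  by rewrite (lt_le_trans _ nx).
have cvgI : (\int[leb]_(x in `[n.+2%:R^-1%R, 1%R]) (x `^ (a - 1))%:E)%E
    @[n --> \oo] --> (\int[leb]_(x in \bigcup_n `[n.+2%:R^-1%R, 1%R]%classic)
      (x `^ (a - 1))%:E)%E.
  apply: ge0_nondecreasing_set_cvg_integral => //.
  - move=> n m nm; rewrite subsetEset.
    by apply: subset_itvr; rewrite bnd_simp lef_pV2 ?posrE// ler_nat.
  - move=> n; apply/measurable_EFinP/measurable_funTS; exact: measurable_powR.
  - by move=> n x _; rewrite lee_fin powR_ge0.
move/cvg_lim : (cvgI) => <- //; apply: lime_le.
  by apply/cvg_ex; eexists; exact: cvgI.
apply: nearW => n.
rewrite (@continuous_FTC2 _ _ (fun x => a^-1 * x `^ a)).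
  + rewrite powR1 mulr1 -EFinB lee_fin gerBl// mulr_ge0 ?powR_ge0//.
    by rewrite invr_ge0 ltW.
  + by rewrite invf_lt1// ltr1n.
  + apply: derivable_within_continuous => x; rewrite in_itv/= => /andP[nx _].
    apply: derivable_powR; rewrite in_itv/= andbT.
    by rewrite (lt_le_trans _ nx)// invr_gt0.
  + have dF (x : R) : n.+2%:R^-1 <= x -> derivable (fun x => a^-1 * x `^ a) x 1.
      move=> nx; apply: derivableM; first by apply: derivable_cst.
      apply: derivable_powR; rewrite in_itv/= andbT.
      by rewrite (lt_le_trans _ nx).
    have cF (x : R) : n.+2%:R^-1 <= x ->
        {for x, continuous (fun x => a^-1 * x `^ a)}.
      by move=> nx; apply: differentiable_continuous; exact/derivable1_diffP/dF.
    split.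
    * by move=> x; rewrite in_itv/= => /andP[/ltW nx _]; exact: dF.
    * by apply: cvg_at_right_filter; exact: cF.
    * by apply: cvg_at_left_filter; apply: cF; rewrite invf_le1 ?ler1n.
  + move=> x; rewrite in_itv/= => /andP[nx _].
    have x0 : 0 < x by rewrite (lt_trans _ nx).
    rewrite derive1Ml; last by apply: derivable_powR; rewrite in_itv/= andbT.
    by rewrite powR_derive1 ?in_itv/= ?andbT// mulrA mulVf ?gt_eqF// mul1r.
Qed.

(** Beyond [t] the power [x ^ a] is at most [x ^ (a + 2) / t ^ 2]; the raised power is then absorbed
    by half of the exponential decay. The extra factor 4 normalizes the exponential density, whose
    total mass is 1. *)
Lemma tail_kernel_le (k : nat) (a : R) : a <= k%:R ->
  exists2 C : R, 0 < C & forall t, 1 <= t ->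
    (\int[leb]_(x in `]t, +oo[) (x `^ a * expR (- (2^-1 * x)))%:E
      <= (C / t ^+ 2)%:E)%E.
Proof.
move=> ak; set C : R := 4 ^+ k.+3 * (k.+3)`!%:R.
have C0 : 0 < C by rewrite mulr_gt0// ?exprn_gt0// ltr0n fact_gt0.
exists (C * 4); first by rewrite mulr_gt0.
move=> t t1; have t0 : 0 < t by exact: lt_le_trans t1.
have q0 : (0 : R) < 4^-1 by [].
have D0 : 0 <= C * 4 / t ^+ 2.
  by apply: divr_ge0; [rewrite mulr_ge0// ltW | rewrite exprn_ge0// ltW].
have mexp := @measurable_exponential_pdf R 4^-1.
apply: (@le_trans _ _
  (\int[leb]_(x in `]t, +oo[) ((C * 4 / t ^+ 2)%:E *
                               (exponential_pdf 4^-1 x)%:E))%E).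
  apply: ge0_le_integral => //=.
  - by move=> x _; rewrite lee_fin mulr_ge0 ?powR_ge0 ?expR_ge0.
  - apply/measurable_EFinP/measurable_funTS.
    by under eq_fun do rewrite -mulNr; exact: mkern.
  - apply: measurable_funeM.
    exact/measurable_EFinP/measurable_funTS.
  move=> x; rewrite in_itv/= andbT => tx.
  have x1 : 1 <= x by rewrite (le_trans t1)// ltW.
  have x0 : 0 < x by exact: lt_le_trans x1.
  rewrite -EFinM lee_fin exponential_pdfE ?(ltW x0)// mulrA.
  rewrite [_ / _ * 4^-1]mulrAC mulfK// mulrAC ler_pdivlMr ?exprn_gt0//.
  have a2k : a + 2 <= (k + 2)%:R by rewrite natrD lerD2r.
  have := powR_expR_le a2k x1; rewrite addn2 mulNr; apply: le_trans.
  rewrite mulrAC ler_pM2r ?expR_gt0// powRD; last first.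
    by apply/implyP => _; rewrite gt_eqF.
  rewrite ler_wpM2l ?powR_ge0// powR_mulrn ?(ltW x0)//.
  by rewrite lerXn2r ?nnegrE ?ltW.
rewrite ge0_integralZl_EFin//=.
- apply: (@le_trans _ _ ((C * 4 / t ^+ 2)%:E *
      \int[leb]_x (exponential_pdf 4^-1 x)%:E)%E).
    apply: lee_wpmul2l; first by rewrite lee_fin.
    apply: ge0_subset_integral => //=; first exact/measurable_EFinP.
    by move=> x _; rewrite lee_fin exponential_pdf_ge0.
  by rewrite integral_exponential_pdf// mule1.
- by move=> x _; rewrite lee_fin exponential_pdf_ge0.
- exact/measurable_EFinP/measurable_funTS.
Qed.

(** On this interval the power is at least [2^-1] and the exponential at least [expR (- 2)]. The
    case [c = 1] serves [Gamma] and [c = 2^-1] the chi-square density. *)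
Lemma kernel_itv12_gt0 (a c : R) : -1 <= a -> c <= 1 ->
  (0 < \int[leb]_(x in `]1%R, 2%R]) (x `^ a * expR (- (c * x)))%:E)%E.
Proof.
move=> a1 c1.
apply: (@lt_le_trans _ _
  (\int[leb]_(x in `]1%R, 2%R]) (2^-1 * expR (- 2) : R)%:E)%E).
  rewrite integral_cst//= lebesgue_measure_itv/= lte_fin ltr1n -EFinB -EFinM.
  have -> : 2 - 1 = 1 :> R by lra.
  by rewrite mulr1 lte_fin mulr_gt0 ?expR_gt0.
apply: ge0_le_integral => //=.
- apply/measurable_EFinP/measurable_funTS.
  by under eq_fun do rewrite -mulNr; exact: mkern.
move=> x; rewrite in_itv/= => /andP[x1 x2].
have x0 : 0 < x by exact: lt_trans x1.
rewrite lee_fin ler_pM ?expR_ge0//.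
  apply: (@le_trans _ _ (x `^ (-1))).
    by rewrite powR_inv1 ?(ltW x0)// lef_pV2 ?posrE.
  by apply: ler_powR => //; exact: ltW.
rewrite ler_expR lerN2; nra.
Qed.

(** [Gamma] is the [fine] part of an extended integral, and [fine +oo] is 0, so finiteness must be
    shown along with positivity. The integral is split at 1: the power dominates near 0, the
    exponential at infinity. *)
Lemma Gamma_gt0 (k : nat) (a : R) : 0 < a -> a <= k%:R -> 0 < Gamma a.
Proof.
move=> a0 ak; rewrite /Gamma /Rintegral.
have mg : measurable_fun [set: R] (fun x : R => x `^ (a - 1) * expR (- x)).
  by have := mkern (-1) (a - 1); under eq_fun do rewrite mulN1r.
have ge0g (x : R) : (0 <= (x `^ (a - 1) * expR (- x))%:E)%E.
  by rewrite lee_fin mulr_ge0 ?powR_ge0 ?expR_ge0.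
apply: fine_gt0; apply/andP; split.
  apply: (@lt_le_trans _ _ (\int[leb]_(x in `]1%R, 2%R])
      (x `^ (a - 1) * expR (- (1 * x)))%:E)%E).
    by apply: kernel_itv12_gt0 => //; lra.
  under [leLHS]eq_integral do rewrite mul1r.
  apply: ge0_subset_integral => //=.
    exact/measurable_EFinP/measurable_funTS.
  by move=> x /=; rewrite !in_itv/= andbT => /andP[x1 _]; exact: lt_trans x1.
have -> : `]0, +oo[%classic = `]0, 1]%classic `|` `]1, +oo[%classic :> set R.
  by rewrite -itv_bndbnd_setU// bnd_simp.
rewrite ge0_integral_setU//=; last 2 first.
- exact/measurable_EFinP/measurable_funTS.
- apply/disj_setPS => x []; rewrite /= !in_itv/= andbT => /andP[_ x1].
  by rewrite ltNge x1.
have h1 := integral_powR_oc01_le a0.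
have ak1 : a - 1 <= k%:R by lra.
have [C C0 /(_ 1 (lexx _)) h2] := tail_kernel_le ak1.
apply: le_lt_trans (ltry (a^-1 + C / 1 ^+ 2)).
rewrite EFinD; apply: leeD.
  apply: le_trans h1; apply: ge0_le_integral => //=.
  - exact/measurable_EFinP/measurable_funTS.
  - by apply/measurable_EFinP/measurable_funTS; exact: measurable_powR.
  move=> x; rewrite in_itv/= => /andP[x0 _].
  by rewrite lee_fin ler_piMr ?powR_ge0// expR_le1 oppr_le0 ltW.
apply: le_trans h2; apply: ge0_le_integral => //=.
- exact/measurable_EFinP/measurable_funTS.
- apply/measurable_EFinP/measurable_funTS.
  by under eq_fun do rewrite -mulNr; exact: mkern.
move=> x; rewrite in_itv/= andbT => x1.
by rewrite lee_fin ler_wpM2l ?powR_ge0// ler_expR lerN2; lra.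
Qed.

Section degrees.
Variables (k : nat) (k0 : (0 < k)%N).

Let nrm : R := 2 `^ (k%:R / 2) * Gamma (k%:R / 2).

Let nrm_gt0 : 0 < nrm.
Proof.
rewrite mulr_gt0 ?powR_gt0// (@Gamma_gt0 k) ?divr_gt0 ?ltr0n//.
by rewrite ler_pdivrMr// ler_peMr// ler1n.
Qed.

Let chi2_pdfE (x : R) : 0 < x ->
  chi2_pdf k x = nrm^-1 * (x `^ (k%:R / 2 - 1) * expR (- (2^-1 * x))).
Proof.
by move=> x0; rewrite /chi2_pdf x0 [RHS]mulrC -/nrm mulNr (mulrC 2^-1).
Qed.

Let mpdf (D : set R) : measurable D -> D `<=` `]0, +oo[%classic ->
  measurable_fun D (chi2_pdf k).
Proof.
move=> mD D0; apply: (eq_measurable_fun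
    (fun x => nrm^-1 * (x `^ (k%:R / 2 - 1) * expR (- (2^-1 * x))))).
  by move=> x /set_mem/D0 /=; rewrite in_itv/= andbT => x0; rewrite chi2_pdfE.
apply: measurable_funM => //; apply: measurable_funTS.
by under eq_fun do rewrite -mulNr; exact: mkern.
Qed.

Let chi2_pdf_ge0 (x : R) : 0 <= chi2_pdf k x.
Proof.
have [x0|x0] := ltP 0 x; last by rewrite /chi2_pdf ltNge x0.
by rewrite chi2_pdfE// !mulr_ge0 ?invr_ge0 ?powR_ge0 ?expR_ge0 ?ltW.
Qed.

Let chi2E (D : set R) : measurable D -> D `<=` `]0, +oo[%classic ->
  (chi2 k D = (nrm^-1)%:E *
    \int[leb]_(x in D) (x `^ (k%:R / 2 - 1) * expR (- (2^-1 * x)))%:E)%E.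
Proof.
move=> mD D0; rewrite /chi2 -ge0_integralZl_EFin//.
- apply: eq_integral => x /set_mem/D0 /=; rewrite in_itv/= andbT => x0.
  by rewrite chi2_pdfE// EFinM.
- by move=> x _; rewrite lee_fin mulr_ge0 ?powR_ge0 ?expR_ge0.
- apply/measurable_EFinP/measurable_funTS.
  by under eq_fun do rewrite -mulNr; exact: mkern.
- by rewrite invr_ge0 ltW.
Qed.

Lemma chi2_tail_le : exists2 C : R, 0 < C &
  forall t, 1 <= t -> (chi2 k `]t, +oo[ <= (C / t ^+ 2)%:E)%E.
Proof.
have kk : k%:R / 2 - 1 <= k%:R :> R.
  by have : (0 : R) <= k%:R by []; lra.
have [C C0 h] := tail_kernel_le kk.
exists (nrm^-1 * C); first by rewrite mulr_gt0 ?invr_gt0.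
move=> t t1; rewrite chi2E//; last first.
  by apply: subset_itvr; rewrite bnd_simp (le_trans _ t1).
rewrite -mulrA EFinM lee_wpmul2l ?h//.
by rewrite lee_fin invr_ge0 ltW.
Qed.

Lemma chi2_itv1y_gt0 : (0 < @chi2 R k `]1%R, +oo[%classic)%E.
Proof.
apply: (@lt_le_trans _ _ (@chi2 R k `]1%R, 2%R]%classic)).
  rewrite chi2E//; last first.
    by move=> x /=; rewrite !in_itv/= andbT => /andP[x1 _]; exact: lt_trans x1.
  rewrite mule_gt0 ?lte_fin ?invr_gt0// kernel_itv12_gt0//; last lra.
  by have : (0 : R) <= k%:R by []; lra.
apply: ge0_subset_integral => //=.
- apply/measurable_EFinP; apply: mpdf => //.
  by apply: subset_itvr; rewrite bnd_simp.
- by move=> x _; rewrite lee_fin.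
- exact: subset_itvl.
Qed.

(** The quantile is an [inf], meaningful only for a nonempty set that is bounded below. The tail
    bound puts [e n / 2] in the set. Conversely, once [b / n] falls below the mass of the half-line
    above 1, no point under 1 belongs to it. Positivity matters because the scan divides by its
    thresholds. *)
Lemma upper_quantile_chi2_near (b e : R) : 0 < b -> 0 < e ->
  \forall n \near \oo,
    0 < upper_quantile (@chi2 R k) (b / n%:R) < e * n%:R.
Proof.
move=> b0 e0.
have [C C0 tailC] := chi2_tail_le.
have [c /= c0 chic] : exists2 c : R, 0 < c &
    (c%:E <= @chi2 R k `]1%R, +oo[%classic)%E.
  move: chi2_itv1y_gt0; case: (@chi2 R k _) => [r|_|//].
    by rewrite lte_fin => r0; exists r.
  by exists 1; rewrite ?leey.
near=> n.
have n0 : (0 : R) < n%:R by near: n; exact: nbhs_infty_gtr.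
(* The tail at [t] is at most [4 C / (e n)^2], which is eventually below [b / n]; halving leaves
   room for the strict upper bound. *)
pose t := e * n%:R / 2.
have t1 : 1 <= t.
  rewrite /t ler_pdivlMr// mul1r mulrC -ler_pdivrMr//.
  by near: n; exact: nbhs_infty_ger.
have t0 : 0 < t by exact: lt_le_trans t1.
set S := [set t0 : R | (chi2 k `]t0, +oo[ <= (b / n%:R)%:E)%E].
have St : S t.
  rewrite /S /=; apply: le_trans (tailC _ t1) _; rewrite lee_fin.
  have t2 : t ^+ 2 = (e ^+ 2 / 4) * n%:R * n%:R by rewrite /t; field.
  rewrite t2 ler_pdivrMr ?mulr_gt0 ?exprn_gt0//.
  have -> : b / n%:R * (e ^+ 2 / 4 * n%:R * n%:R) = b * (e ^+ 2 / 4) * n%:R.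
    by field; rewrite gt_eqF.
  rewrite -ler_pdivrMl ?mulr_gt0 ?divr_gt0 ?exprn_gt0//.
  by near: n; exact: nbhs_infty_ger.
have Slb x : S x -> 1 <= x.
  rewrite /S /= => Sx; rewrite leNgt; apply/negP => x1.
  have {}Sx : (@chi2 R k `]1%R, +oo[%classic <= (b / n%:R)%:E)%E.
    apply: le_trans Sx; apply: ge0_subset_integral => //=.
    - apply/measurable_EFinP.
      rewrite /chi2_pdf; apply: measurable_fun_if => //.
      + by apply: measurable_fun_ltr => //; exact: measurable_cst.
      + apply: measurable_funM => //; apply: measurable_funTS.
        under eq_fun do rewrite mulNr mulrC (mulrC _ 2^-1) -mulNr.
        by under eq_fun do rewrite mulrC; exact: mkern.
      + by move=> y _; rewrite lee_fin.
      + by apply: subset_itvr; rewrite bnd_simp ltW.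
  have := le_trans chic Sx; rewrite lee_fin leNgt => /negP; apply.
  rewrite ltr_pdivrMr// mulrC -ltr_pdivrMr//.
  by near: n; exact: nbhs_infty_gtr.
apply/andP; split.
  apply: (@lt_le_trans _ _ 1) => //; apply: lb_le_inf; first by exists t.
  by move=> x; exact: Slb.
apply: (@le_lt_trans _ _ t).
  by apply: ge_inf => //; exists 1 => x; exact: Slb.
by rewrite /t ltr_pdivrMr// ltr_pMr ?mulr_gt0// ltr1n.
Unshelve. all: by end_near. Qed.

End degrees.
End chi_square_tails.

(** * A weak law of large numbers *)

Section weak_law.
Context {R : realType} {dX dO : measure_display} {X : measurableType dX}
  {Omega : measurableType dO} (Q : probability X R) (P : probability Omega R).
Implicit Types (Y : nat -> {RV P >-> X}) (f g : X -> R).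

(* Factorization is only asked for twice the same set: it bounds the variance
   of averages of indicators, and the law of large numbers then extends to all
   integrable functions by density of simple functions in L^1. *)
Definition pairwise_sample Y (a b : nat) : Prop :=
  (forall k, (a <= k < b)%N -> forall A, measurable A ->
     P (Y k @^-1` A) = Q A) /\
  (forall j k, (a <= j < b)%N -> (a <= k < b)%N -> j != k ->
     forall A, measurable A ->
     P (Y j @^-1` A `&` Y k @^-1` A) = (Q A * Q A)%E).

Definition deviation f Y (a b : nat) (w : Omega) : R :=
  \sum_(a <= k < b) (f (Y k w) - \int[Q]_x f x).

(** Uniformity over [Y], [a] and [b] allows a different sample for each [n]. The scale is [n] and
    not the segment length, so short or empty segments need no separate case. Convergence in mean,
    unlike convergence in probability, passes directly to limits in L^1 of [Q]. *)
Definition L1_lln f : Prop :=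
  forall e : R, 0 < e -> exists N, forall n, (N <= n)%N ->
    forall Y a b, (b - a <= n)%N -> pairwise_sample Y a b ->
    (\int[P]_w `|deviation f Y a b w|%:E <= (e * n%:R)%:E)%E.

Let intcst (r : R) : (\int[P]_w r%:E = r%:E)%E.
Proof.
have PT : P setT = 1%E := probability_setT P.
by transitivity (r%:E * 1)%E; [rewrite -PT; exact: integral_cst|exact: mule1].
Qed.

Let measurable_comp_RV f (Y : {RV P >-> X}) :
  measurable_fun setT f -> measurable_fun setT (fun w => f (Y w)).
Proof. by move=> mf; exact: measurableT_comp. Qed.

Lemma measurable_deviation f Y a b : measurable_fun setT f ->
  measurable_fun setT (deviation f Y a b).
Proof.
move=> mf; apply: measurable_sum => k.
by apply: measurable_realfun.measurable_funB => //; exact: measurable_comp_RV.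
Qed.

Lemma integral_sample Y a b k f : pairwise_sample Y a b -> (a <= k < b)%N ->
  measurable_fun setT f -> (forall x, 0 <= f x) ->
  (\int[P]_w (f (Y k w))%:E = \int[Q]_x (f x)%:E)%E.
Proof.
move=> [YQ _] kab mf f0.
rewrite -(@ge0_integral_distribution _ _ _ _ _ _ (Y k) (EFin \o f)) //.
- by apply: eq_measure_integral => A mA _; exact: YQ.
- exact/measurable_EFinP.
Qed.

(** The three thirds of [e] pay for replacing [f] by [g] in the summands, for the deviation of [g],
    and for the difference of the two means. *)
Lemma L1_lln_lim f : Q.-integrable setT (EFin \o f) ->
  (forall e : R, 0 < e -> exists g,
     [/\ Q.-integrable setT (EFin \o g), L1_lln g &
      (\int[Q]_x `|f x - g x|%:E <= e%:E)%E]) ->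
  L1_lln f.
Proof.
move=> intf h e e0; have e30 : 0 < e / 3 by rewrite divr_gt0.
have [g [intg gL fg]] := h _ e30.
have [N HN] := gL _ e30; exists N => n Nn Y a b abn sY.
have mf := measurable_int _ intf; have mg := measurable_int _ intg.
move/measurable_EFinP in mf; move/measurable_EFinP in mg.
have mfg : measurable_fun setT (fun x => `|f x - g x|).
  apply: measurableT_comp => //.
  exact: measurable_realfun.measurable_funB.
have mean_fg : `|\int[Q]_x g x - \int[Q]_x f x| <= e / 3.
  rewrite distrC -RintegralB// -lee_fin EFin_normr_Rintegral//; last first.
    by have := integrableB measurableT intf intg.
  apply: le_trans fg; apply: le_trans (le_abse_integral _ _ _) _ => //.
  by apply/measurable_EFinP; exact: measurable_realfun.measurable_funB.
have n0 : (0 : R) <= n%:R by [].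
apply: (@le_trans _ _ (\int[P]_w (\sum_(a <= k < b) `|f (Y k w) - g (Y k w)|%:E
   + (`|deviation g Y a b w|%:E + (n%:R * (e / 3))%:E)))%E).
  apply: ge0_le_integral => //=.
  - apply/measurable_EFinP; apply: measurableT_comp => //.
    exact: measurable_deviation.
  - apply: emeasurable_funD.
      apply: emeasurable_sum => k; apply/measurable_EFinP.
      exact: (measurable_comp_RV (f := fun x => `|f x - g x|)).
    apply: emeasurable_funD => //; apply/measurable_EFinP.
    by apply: measurableT_comp => //; exact: measurable_deviation.
  move=> w _; rewrite sumEFin -!EFinD lee_fin.
  have -> : deviation f Y a b w = \sum_(a <= k < b) (f (Y k w) - g (Y k w)) +
      (deviation g Y a b w +
       (b - a)%:R * (\int[Q]_x g x - \int[Q]_x f x)).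
    rewrite /deviation mulr_natl -sumr_const_nat -!big_split/=.
    by apply: eq_bigr => k _; ring.
  apply: le_trans (ler_normD _ _) _; apply: lerD; first exact: ler_norm_sum.
  apply: le_trans (ler_normD _ _) _; rewrite lerD2l normrM normr_nat.
  by apply: ler_pM => //; rewrite ler_nat.
rewrite ge0_integralD//=; last first.
- apply: emeasurable_funD => //; apply/measurable_EFinP.
  by apply: measurableT_comp => //; exact: measurable_deviation.
- by move=> w _; rewrite -EFinD lee_fin addr_ge0// mulr_ge0// ltW.
- apply: emeasurable_sum => k; apply/measurable_EFinP.
  exact: (measurable_comp_RV (f := fun x => `|f x - g x|)).
- by move=> w _; rewrite sumEFin lee_fin sumr_ge0.
rewrite ge0_integralD//=; last first.
- by move=> w _; rewrite lee_fin mulr_ge0// ltW.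
- apply/measurable_EFinP; apply: measurableT_comp => //.
  exact: measurable_deviation.
rewrite ge0_integral_sum//=; last first.
  move=> k; apply/measurable_EFinP.
  exact: (measurable_comp_RV (f := fun x => `|f x - g x|)).
have -> : e * n%:R = n%:R * (e / 3) + (e / 3 * n%:R + n%:R * (e / 3)) by field.
rewrite 2!EFinD; apply: leeD; last first.
  apply: leeD; first exact: HN.
  by rewrite intcst.
apply: (@le_trans _ _ (\sum_(a <= k < b) (e / 3)%:E)%E).
  rewrite big_nat_cond [leRHS]big_nat_cond; apply: lee_sum => k /andP[kab _].
  by rewrite (integral_sample (f := fun x => `|f x - g x|) sY).
rewrite sumEFin lee_fin sumr_const_nat -[leLHS]mulr_natl.
by rewrite ler_wpM2r ?ler_nat// ltW.
Qed.

Lemma L1_lln_cst0 : L1_lln (fun=> 0).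
Proof.
move=> e e0; exists 0%N => n _ Y a b _ _.
under eq_integral.
  move=> w _; rewrite /deviation big1; last first.
    by move=> k _; rewrite /Rintegral integral0 subrr.
  rewrite normr0; over.
by rewrite integral0 lee_fin mulr_ge0// ltW.
Qed.

Lemma L1_llnD f g : Q.-integrable setT (EFin \o f) ->
  Q.-integrable setT (EFin \o g) ->
  L1_lln f -> L1_lln g -> L1_lln (f \+ g).
Proof.
move=> intf intg fL gL e e0; have e20 : 0 < e / 2 by rewrite divr_gt0.
have [N HN] := fL _ e20; have [M HM] := gL _ e20.
exists (maxn N M) => n; rewrite geq_max => /andP[Nn Mn] Y a b abn sY.
have mf := measurable_int _ intf; have mg := measurable_int _ intg.
move/measurable_EFinP in mf; move/measurable_EFinP in mg.
have mdev h : measurable_fun setT h ->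
    measurable_fun setT (fun w => `|deviation h Y a b w|%:E).
  move=> mh; apply/measurable_EFinP; apply: measurableT_comp => //.
  exact: measurable_deviation.
apply: (@le_trans _ _ (\int[P]_w (`|deviation f Y a b w|%:E +
   `|deviation g Y a b w|%:E))%E).
  apply: ge0_le_integral => //=.
  - by apply: mdev; exact: measurable_realfun.measurable_funD.
  - by apply: emeasurable_funD; exact: mdev.
  move=> w _; rewrite -EFinD lee_fin.
  have -> : deviation (f \+ g) Y a b w =
      deviation f Y a b w + deviation g Y a b w.
    rewrite /deviation -big_split/=; apply: eq_bigr => k _.
    by rewrite RintegralD//; ring.
  exact: ler_normD.
rewrite ge0_integralD//=; [|exact: mdev|exact: mdev].
have -> : e * n%:R = e / 2 * n%:R + e / 2 * n%:R by field.
by rewrite EFinD; apply: leeD; [exact: HN|exact: HM].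
Qed.

Lemma L1_llnZ f (c : R) : Q.-integrable setT (EFin \o f) ->
  L1_lln f -> L1_lln (fun x => c * f x).
Proof.
move=> intf fL e e0.
have c0 : 0 < `|c| + 1 by rewrite ltr_wpDl.
have [N HN] := fL _ (divr_gt0 e0 c0); exists N => n Nn Y a b abn sY.
have mf := measurable_int _ intf; move/measurable_EFinP in mf.
have -> : (\int[P]_w `|deviation (fun x => (c * f x)%R) Y a b w|%:E =
    \int[P]_w (`|c|%:E * `|deviation f Y a b w|%:E))%E.
  apply: eq_integral => w _; rewrite -EFinM -normrM; congr (`|_|%:E).
  rewrite /deviation mulr_sumr; apply: eq_bigr => k _.
  by rewrite RintegralZl// mulrBr.
rewrite ge0_integralZl_EFin//=; last first.
  apply/measurable_EFinP; apply: measurableT_comp => //.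
  exact: measurable_deviation.
apply: (@le_trans _ _ (`|c|%:E * (e / (`|c| + 1) * n%:R)%:E)%E).
  by apply: lee_wpmul2l; [rewrite lee_fin|exact: HN].
rewrite -EFinM lee_fin mulrA ler_wpM2r//.
by rewrite mulrCA ler_piMr ?(ltW e0)// ler_pdivrMr// mul1r lerDl.
Qed.

(** The second moment of the count [N] is a double sum of joint probabilities: diagonal terms
    contribute [q], the others [q ^ 2]. For an indicator, independence thus enters only through
    pairs of events built on the same set. *)
Lemma integral_sqr_deviation_indic (A : set X) Y a b :
  measurable A -> pairwise_sample Y a b ->
  (\int[P]_w ((deviation \1_A Y a b w) ^+ 2)%:E <= (b - a)%:R%:E)%E.
Proof.
move=> mA sY.
pose q := fine (Q A).
have qE : (Q A = q%:E) by rewrite /q fineK// fin_num_measure.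
have q0 : 0 <= q by rewrite fine_ge0.
have q1 : q <= 1 by rewrite -lee_fin -qE probability_le1.
have mu1 : \int[Q]_x \1_A x = q.
  by rewrite /Rintegral integral_indic// setIT.
pose m : R := (b - a)%:R.
have m0 : 0 <= m by rewrite /m.
pose N w : R := \sum_(a <= k < b) \1_A (Y k w).
have N0 w : 0 <= N w by rewrite sumr_ge0.
have devE w : deviation \1_A Y a b w = N w - m * q.
  by rewrite /deviation mu1 big_split/= sumr_const_nat mulr_natl mulNrn.
have mind : measurable_fun setT (\1_A : X -> R) by exact: measurable_indic.
have mN : measurable_fun setT N.
  by apply: measurable_sum => k; exact: measurable_comp_RV.
have mY k : measurable (Y k @^-1` A).
  by rewrite -[_ @^-1` _]setTI; exact: measurable_funP.
have IN : (\int[P]_w (N w)%:E = (m * q)%:E)%E.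
  under eq_integral do rewrite /N -sumEFin.
  rewrite ge0_integral_sum//=; last first.
    by move=> k; apply/measurable_EFinP; exact: measurable_comp_RV.
  rewrite (eq_big_nat _ _ (F2 := fun=> q%:E)); last first.
    move=> k kab; rewrite (integral_sample sY)// integral_indic// setIT.
    exact: qE.
  by rewrite sumEFin sumr_const_nat mulr_natl.
have IN2 : (\int[P]_w (N w ^+ 2)%:E <= (m * q + (m * q) ^+ 2)%:E)%E.
  have N2E w : ((N w ^+ 2)%:E = \sum_(a <= j < b) \sum_(a <= k < b)
      (\1_(Y j @^-1` A `&` Y k @^-1` A) w)%:E)%E.
    under eq_bigr do rewrite sumEFin.
    rewrite sumEFin expr2 {1}/N mulr_suml; congr EFin; apply: eq_bigr => j _.
    rewrite mulr_sumr; apply: eq_bigr => k _.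
    by rewrite indicI.
  under eq_integral do rewrite N2E.
  have mI j k : measurable_fun setT
      (fun w => (\1_(Y j @^-1` A `&` Y k @^-1` A) w)%:E : \bar R).
    by apply/measurable_EFinP; apply: measurable_indic; exact: measurableI.
  rewrite ge0_integral_sum//=; last 2 first.
  - by move=> j; apply: emeasurable_sum.
  - by move=> j w _; rewrite sumEFin lee_fin sumr_ge0.
  apply: (@le_trans _ _ (\sum_(a <= j < b) (q + m * q ^+ 2)%:E)%E).
    rewrite big_nat_cond [leRHS]big_nat_cond.
    apply: lee_sum => j /andP[jab _].
    rewrite ge0_integral_sum//=.
    apply: (@le_trans _ _
        (\sum_(a <= k < b) (q *+ (k == j) + q ^+ 2)%:E)%E).
      rewrite big_nat_cond [leRHS]big_nat_cond.
      apply: lee_sum => k /andP[kab _].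
      rewrite integral_indic ?setIT//; last exact: measurableI.
      have [->|kj] := eqVneq k j.
        rewrite setIid; apply: (@le_trans _ _ q%:E).
          rewrite -qE le_eqVlt; apply/orP; left; apply/eqP; exact: sY.1.
        by rewrite lee_fin mulr1n lerDl sqr_ge0.
      rewrite mulr0n add0r expr2 EFinM -qE.
      rewrite le_eqVlt; apply/orP; left; apply/eqP.
      by apply: sY.2; rewrite // eq_sym.
    rewrite sumEFin lee_fin big_split/= sumr_const_nat mulr_natl lerD2r.
    rewrite (bigD1_seq j) ?mem_index_iota ?iota_uniq//= eqxx mulr1n.
    by rewrite big1 ?addr0// => k /negbTE ->; rewrite mulr0n.
  rewrite sumEFin lee_fin sumr_const_nat -[leLHS]mulr_natl -/m.
  by rewrite mulrDr exprMn mulrA -expr2.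
(* In the expansion of [(N - m q) ^ 2] the cross term is moved to the other side, so that only
   integrals of nonnegative functions occur. *)
have key : (\int[P]_w ((deviation \1_A Y a b w) ^+ 2)%:E +
    (2 * (m * q) ^+ 2)%:E <= m%:E + (2 * (m * q) ^+ 2)%:E)%E.
  apply: (@le_trans _ _ (\int[P]_w (N w ^+ 2)%:E + ((m * q) ^+ 2)%:E)%E).
    have -> : ((2 * (m * q) ^+ 2)%:E = \int[P]_w (2 * (m * q) * N w)%:E)%E.
      under eq_integral do rewrite EFinM.
      rewrite ge0_integralZl_EFin//=.
      - by rewrite IN -EFinM; congr EFin; ring.
      - by move=> w _; rewrite lee_fin.
      - exact/measurable_EFinP.
      - by rewrite !mulr_ge0.
    have -> : (((m * q) ^+ 2)%:E = \int[P]_w ((m * q) ^+ 2)%:E)%E.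
      by rewrite intcst.
    have mD2 : measurable_fun setT
        (fun w => (deviation \1_A Y a b w ^+ 2)%:E).
      apply/measurable_EFinP; apply: measurable_realfun.measurable_funX.
      exact: measurable_deviation.
    rewrite -ge0_integralD//=; last 3 first.
    - by move=> w _; rewrite lee_fin sqr_ge0.
    - by move=> w _; rewrite lee_fin !mulr_ge0.
    - by apply/measurable_EFinP; exact: measurable_funM.
    rewrite -ge0_integralD//=; last 3 first.
    - by move=> w _; rewrite lee_fin sqr_ge0.
    - by apply/measurable_EFinP; apply: measurable_realfun.measurable_funX.
    - by move=> w _; rewrite lee_fin sqr_ge0.
    rewrite le_eqVlt; apply/orP; left; apply/eqP.
    by apply: eq_integral => w _; rewrite -!EFinD devE; congr EFin; ring.
  apply: le_trans (leeD2r _ IN2) _; rewrite -!EFinD lee_fin.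
  suff : m * q <= m by lra.
  by rewrite ler_piMr.
by move: key; rewrite leeD2rE.
Qed.

Lemma L1_lln_indic (A : set X) : measurable A -> L1_lln \1_A.
Proof.
(* From [n >= e ^- 2] on, the variance part [1 / (2 e)] of the bound below is at most [e n / 2]. *)
move=> mA e e0; exists (Num.truncn (e ^- 2)).+1 => n Nn Y a b abn sY.
have en : e ^- 2 <= n%:R.
  by rewrite (le_trans (ltW (truncnS_gt _)))// ler_nat.
have n0 : (0 : R) < n%:R by rewrite (lt_le_trans _ en)// invr_gt0 exprn_gt0.
pose c : R := (2 * (e * n%:R))^-1.
have c0 : 0 < c by rewrite invr_gt0 !mulr_gt0.
have mD : measurable_fun setT (deviation \1_A Y a b).
  exact/measurable_deviation/measurable_indic.
(* AM-GM: |z| <= z^2 / (2 e n) + e n / 2 *)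
apply: (@le_trans _ _ (\int[P]_w (c%:E * ((deviation \1_A Y a b w) ^+ 2)%:E +
   (e * n%:R / 2)%:E))%E).
  apply: ge0_le_integral => //=.
  - by apply/measurable_EFinP; apply: measurableT_comp.
  - apply: emeasurable_funD => //; apply: measurable_funeM.
    by apply/measurable_EFinP; exact: measurable_realfun.measurable_funX.
  move=> w _; rewrite -EFinM -EFinD lee_fin.
  set z := deviation _ _ _ _ _.
  rewrite -(real_normK (num_real z)); set y := `|z|.
  rewrite -subr_ge0.
  have -> : c * y ^+ 2 + e * n%:R / 2 - y = c * (y - e * n%:R) ^+ 2.
    by rewrite /c; field; rewrite !gt_eqF.
  by rewrite mulr_ge0 ?sqr_ge0 ?ltW.
have en0 : 0 <= e * n%:R / 2 by rewrite !mulr_ge0 ?invr_ge0 ?ltW.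
have mD2 : measurable_fun setT
    (fun w => (deviation \1_A Y a b w ^+ 2)%:E).
  by apply/measurable_EFinP; exact: measurable_realfun.measurable_funX.
rewrite ge0_integralD//=; last 2 first.
- by move=> w _; rewrite -EFinM lee_fin mulr_ge0 ?sqr_ge0 ?ltW.
- exact: measurable_funeM.
rewrite ge0_integralZl_EFin//=; last 2 first.
- by move=> w _; rewrite lee_fin sqr_ge0.
- exact: ltW.
rewrite intcst.
apply: (@le_trans _ _ (c%:E * n%:R%:E + (e * n%:R / 2)%:E)%E).
  rewrite leeD2r// lee_wpmul2l ?lee_fin ?(ltW c0)//.
  apply: le_trans (integral_sqr_deviation_indic mA sY) _.
  by rewrite lee_fin ler_nat.
rewrite -EFinM -EFinD lee_fin.
have -> : c * n%:R = e^-1 / 2 by rewrite /c; field; rewrite !gt_eqF.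
suff : e^-1 <= e * n%:R by lra.
rewrite -ler_pdivrMl//.
by move: en; rewrite -exprVn expr2.
Qed.

Import HBSimple.

Lemma L1_lln_integrable f : Q.-integrable setT (EFin \o f) -> L1_lln f.
Proof.
move=> intf; apply: L1_lln_lim => // e e0.
have [g_ [intg _ cvg0]] := approximation_sfun_integrable measurableT intf.
have [n _ /(_ n (leqnn n)) hn] : \forall n \near \oo,
    (\int[Q]_z `|(EFin \o f) z - (g_ n z)%:E| < e%:E)%E.
  have /(_ _) := cvg0 [set y | (y < e%:E)%E]; apply.
  by apply: open_ereal_lt'; rewrite lte_fin.
exists (g_ n); split; first exact: intg.
  pose s : seq R := finmap.enum_fset (fset_set (range (g_ n))).
  pose h (i : 'I_(size s)) x := s`_i * \1_(g_ n @^-1` [set s`_i]) x.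
  have -> : (g_ n : X -> R) = fun x => \sum_i h i x.
    by apply/funext => x; rewrite fimfunEord.
  (* The induction on the list of values carries integrability along, as additivity of the law of
     large numbers requires it of both summands. *)
  suff : forall r : seq 'I_(size s),
      Q.-integrable setT (EFin \o (fun x => \sum_(i <- r) h i x)) /\
      L1_lln (fun x => \sum_(i <- r) h i x) by move=> /(_ (index_enum _))[].
  elim=> [|i r [ih1 ih2]].
    have -> : (fun x => \sum_(i <- [::]) h i x) = fun=> 0.
      by apply/funext => x; rewrite big_nil.
    by split; [exact: integrable0|exact: L1_lln_cst0].
  have -> : (fun x => \sum_(i <- i :: r) h i x) =
      h i \+ (fun x => \sum_(i <- r) h i x).
    by apply/funext => x; rewrite big_cons.
  have mA : measurable (g_ n @^-1` [set s`_i]) by [].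
  have int1 := @integrable_indic _ _ R Q _ mA.
  have int1c : Q.-integrable setT (EFin \o h i) :=
    integrableZl measurableT s`_i int1.
  split; first by have := integrableD measurableT int1c ih1.
  have hL : L1_lln (h i) by apply: L1_llnZ int1 _; exact: L1_lln_indic.
  exact: L1_llnD int1c ih1 hL ih2.
apply: le_trans (ltW hn); rewrite le_eqVlt; apply/orP; left; apply/eqP.
by apply: eq_integral.
Qed.

(** Markov's inequality applied to the mean bound at accuracy [e * h]; the shift to [N.+1] makes [n]
    positive. *)
Lemma weak_lln f (e h : R) : Q.-integrable setT (EFin \o f) ->
  0 < e -> 0 < h -> exists N, forall n, (N <= n)%N ->
    forall Y a b, (b - a <= n)%N -> pairwise_sample Y a b ->
    (P [set w : Omega | (e * n%:R <= `|deviation f Y a b w|)%R] <= h%:E)%E.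
Proof.
move=> intf e0 h0.
have [N HN] := L1_lln_integrable intf (mulr_gt0 e0 h0).
exists N.+1 => n Nn Y a b abn sY.
have n0 : (0 : R) < n%:R by rewrite ltr0n (leq_trans _ Nn).
have {}HN := HN n (ltnW Nn) Y a b abn sY.
have mf := measurable_int _ intf; move/measurable_EFinP in mf.
have mD : measurable_fun setT (fun w => `|deviation f Y a b w|).
  by apply: measurableT_comp => //; exact: measurable_deviation.
set E := [set w | _].
have mE : measurable E.
  have -> : E = (fun w => `|deviation f Y a b w|) @^-1` `[e * n%:R, +oo[.
    by apply/seteqP; split => w; rewrite /E /= in_itv/= andbT.
  by rewrite -[_ @^-1` _]setTI; exact: mD.
rewrite -(@lee_pmul2l _ (e * n%:R)%:E) ?lte_fin ?mulr_gt0//; last first.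
rewrite -EFinM mulrAC; apply: le_trans HN.
have -> : (P E = \int[P]_w (\1_E w)%:E)%E by rewrite integral_indic// setIT.
rewrite -ge0_integralZl_EFin//=.
- apply: ge0_le_integral => //=.
  + by move=> w _; rewrite -EFinM lee_fin !mulr_ge0// ltW.
  + by apply: measurable_funeM; apply/measurable_EFinP; exact: measurable_indic.
  + exact/measurable_EFinP.
  move=> w _; rewrite -EFinM lee_fin indicE.
  by case: (boolP (w \in E)) => [/set_mem|_]; rewrite ?mulr1 ?mulr0.
- by apply/measurable_EFinP; exact: measurable_indic.
- by rewrite mulr_ge0 ?ltW.
Qed.

End weak_law.

(** * Inner probabilities tending to one *)

Section inner_probability.
Context {R : realType} {dO : measure_display} {Omega : measurableType dO}
  (P : probability Omega R).
Implicit Types A B : nat -> set Omega.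

Definition whp A : Prop := inner_prob P (A n) @[n --> \oo] --> 1%E.

Lemma probability_setC_fin (E : set Omega) (e : R) : measurable E ->
  ((1 - e)%:E <= P E)%E = (P (~` E) <= e%:E)%E.
Proof.
move=> mE; rewrite probability_setC//.
have /fineK <- : P E \is a fin_num by exact: fin_num_measure.
by rewrite -EFinB !lee_fin lerBlDr lerBlDl.
Qed.

(** Replacing the supremum by measurable witnesses makes these events closed under finite
    intersection: the bounds on complements simply add up. *)
Lemma whpP A : whp A <-> forall e : R, 0 < e -> \forall n \near \oo,
  exists E, [/\ measurable E, E `<=` A n & (P (~` E) <= e%:E)%E].
Proof.
have ge_inner (B : set Omega) E :
    measurable E -> E `<=` B -> (P E <= inner_prob P B)%E.
  by move=> mE EB; apply: ereal_sup_ubound; exists E.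
have inner_le1 (B : set Omega) : (inner_prob P B <= 1)%E.
  by apply: ge_ereal_sup => _ [E [mE _] <-]; exact: probability_le1.
split=> [h e e0|h].
  have /(_ _) := h [set y | ((1 - e)%:E < y)%E].
  case=> [|N _ hN].
    by apply: open_ereal_gt'; rewrite lte_fin ltrBlDr ltrDl.
  exists N => // n Nn.
  have /= /ereal_sup_gt[_ [E [mE EA] <-] /ltW hE] := hN n Nn.
  by exists E; split=> //; rewrite -probability_setC_fin.
apply/fine_cvgP; split.
  apply: nearW => n; rewrite ge0_fin_numE.
    exact: le_lt_trans (inner_le1 _) (ltry 1).
  by apply: le_trans (ge_inner _ set0 measurable0 (@sub0set _ _)).
apply/cvgrPdist_le => e e0; have [N _ hN] := h _ e0.
exists N => // n Nn /=; have [E [mE EA PE]] := hN n Nn.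
have h1 := inner_le1 (A n); have h2 := ge_inner _ _ mE EA.
move: PE; rewrite -probability_setC_fin// => PE.
have {h2}PE := le_trans PE h2.
move: (inner_prob P (A n)) h1 PE => [r||]//=; rewrite !lee_fin => h1 PE.
by rewrite ger0_norm ?subr_ge0// lerBlDl -lerBlDr.
Qed.

Lemma whpS A B : (\forall n \near \oo, A n `<=` B n) -> whp A -> whp B.
Proof.
move=> AB /whpP hA; apply/whpP => e e0; near=> n.
have [E [mE EA PE]] : exists E,
   [/\ measurable E, E `<=` A n & (P (~` E) <= e%:E)%E] by near: n; exact: hA.
by exists E; split=> //; apply: subset_trans EA _; near: n.
Unshelve. all: by end_near. Qed.

Lemma whpI A B : whp A -> whp B -> whp (fun n => A n `&` B n).
Proof.
move=> /whpP hA /whpP hB; apply/whpP => e e0.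
have e20 : 0 < e / 2 by rewrite divr_gt0.
near=> n.
have [E [mE EA PE]] : exists E,
   [/\ measurable E, E `<=` A n & (P (~` E) <= (e / 2)%:E)%E].
  by near: n; exact: hA.
have [F [mF FB PF]] : exists E,
   [/\ measurable E, E `<=` B n & (P (~` E) <= (e / 2)%:E)%E].
  by near: n; exact: hB.
exists (E `&` F); split; [exact: measurableI|exact: setISS|].
rewrite setCI; apply: le_trans (measureU2 _ _ _) _; try exact: measurableC.
by rewrite [e]splitr EFinD; exact: leeD.
Unshelve. all: by end_near. Qed.

Lemma whpT : whp (fun=> setT).
Proof.
apply/whpP => e e0; apply: nearW => n; exists setT; split => //.
by rewrite setCT measure0 lee_fin ltW.
Qed.

Lemma whp_forall (I : finType) (A : I -> nat -> set Omega) :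
  (forall i, whp (A i)) -> whp (fun n => [set w | forall i, A i n w]).
Proof.
move=> hA.
suff H (s : seq I) : whp (fun n => [set w | forall i, i \in s -> A i n w]).
  apply: whpS (H (enum I)); apply: nearW => n w h i; apply: h.
  by rewrite mem_enum.
elim: s => [|i s ih].
  by apply: whpS whpT; apply: nearW => n w _ i.
apply: whpS (whpI (hA i) ih); apply: nearW => n w [hi hs] j.
by rewrite inE => /predU1P[->//|]; exact: hs.
Qed.

End inner_probability.

(** * Averages and almost sure properties along a triangular array *)

Section triangular_array.
Context {R : realType} {dX dO : measure_display} {X : measurableType dX}
  {Omega : measurableType dO} (Q : probability X R) (P : probability Omega R).
Variables (Y : nat -> nat -> {RV P >-> X}) (a b : nat -> nat) (rho : R).
Hypothesis sY : \forall n \near \oo,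
  (b n - a n <= n)%N /\ pairwise_sample Q (Y n) (a n) (b n).
Hypothesis cvg_rho : (b n - a n)%:R / n%:R @[n --> \oo] --> rho.

(** Sums over a segment are divided by [n], so the limit carries the asymptotic fraction [rho] of
    the segment. The error splits into the centred sum and the gap between [rho] and the actual
    fraction, times the mean; [|mu| + 1] avoids a division by zero. *)
Lemma whp_mean (f : X -> R) (e : R) : Q.-integrable setT (EFin \o f) -> 0 < e ->
  whp P (fun n => [set w | `|n%:R^-1 * \sum_(a n <= k < b n) f (Y n k w) -
    rho * \int[Q]_x f x| < e]).
Proof.
move=> intf e0; have e20 : 0 < e / 2 by rewrite divr_gt0.
have mf := measurable_int _ intf; move/measurable_EFinP in mf.
set mu := \int[Q]_x f x.
apply/whpP => h h0; have [N HN] := weak_lln P intf e20 h0.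
have mu0 : 0 < `|mu| + 1 by rewrite ltr_wpDl.
have /cvgrPdist_lt/(_ _ (divr_gt0 e20 mu0)) near_rho := cvg_rho.
near=> n.
have n0 : (0 : R) < n%:R by near: n; exact: nbhs_infty_gtr.
have [abn sYn] : (b n - a n <= n)%N /\ pairwise_sample Q (Y n) (a n) (b n).
  by near: n.
have {}HN := HN n _ (Y n) (a n) (b n) abn sYn.
set D := [set w | _] in HN.
have mD : measurable D.
  have -> : D = (fun w => `|deviation Q f (Y n) (a n) (b n) w|) @^-1`
      `[e / 2 * n%:R, +oo[.
    by apply/seteqP; split => w; rewrite /D /= in_itv/= andbT.
  rewrite -[_ @^-1` _]setTI.
  have : measurable_fun setT (fun w => `|deviation Q f (Y n) (a n) (b n) w|).
    by apply: measurableT_comp => //; exact: measurable_deviation.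
  exact.
exists (~` D); split; [exact: measurableC| |]; last first.
  by rewrite setCK; apply: HN; near: n; exact: nbhs_infty_ge.
move=> w /negP; rewrite /= -ltNge => hD.
have -> : n%:R^-1 * \sum_(a n <= k < b n) f (Y n k w) - rho * mu =
    n%:R^-1 * deviation Q f (Y n) (a n) (b n) w -
    (rho - (b n - a n)%:R / n%:R) * mu.
  rewrite /deviation big_split/= sumrN sumr_const_nat -/mu -[mu *+ _]mulr_natl.
  by ring.
rewrite [e]splitr; apply: le_lt_trans (ler_normB _ _) _; apply: ltrD.
  by rewrite normrM gtr0_norm ?invr_gt0// ltr_pdivrMl// mulrC.
rewrite normrM; apply: (@le_lt_trans _ _
    (`|rho - (b n - a n)%:R / n%:R| * (`|mu| + 1))).
  by rewrite ler_wpM2l// lerDl.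
by rewrite -ltr_pdivlMr//; near: n.
Unshelve. all: by end_near. Qed.

(** Each row has finitely many observations, so the exceptional event is covered by a finite union
    of null sets. *)
Lemma whp_ae (G : X -> Prop) : {ae Q, forall x, G x} ->
  whp P (fun n => [set w | forall k, (a n <= k < b n)%N -> G (Y n k w)]).
Proof.
move=> [N [mN QN GN]]; apply/whpP => e e0; near=> n.
have [_ [YQ _]] : (b n - a n <= n)%N /\ pairwise_sample Q (Y n) (a n) (b n).
  by near: n.
pose B := \big[setU/set0]_(a n <= k < b n) (Y n k @^-1` N).
have mY k : measurable (Y n k @^-1` N).
  by rewrite -[_ @^-1` _]setTI; exact: measurable_funP.
exists (~` B); split.
- by apply: measurableC; exact: bigsetU_measurable.
- move=> w Bw k kab; apply: contrapT => nG; apply: Bw.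
  rewrite /B -bigcup_seq; exists k => /=; first by rewrite mem_index_iota.
  exact: GN.
- rewrite setCK (_ : P B = 0%E) ?lee_fin ?(ltW e0)//.
  apply: measure_negligible; first exact: bigsetU_measurable.
  rewrite /B big_nat_cond; elim/big_ind : _ => [|C D|k /andP[kab _]].
  + exact: negligible_set0.
  + exact: negligibleU.
  + apply/negligibleP => //; rewrite -QN; exact: YQ.
Unshelve. all: by end_near. Qed.

End triangular_array.

(** * The pre- and post-change segments as samples of a single law *)

Section changepoint_sample.
Context {R : realType} {d : nat} {dX dO : measure_display}
  {X : measurableType dX} {Omega : measurableType dO}
  (Pr : 'cV[R]_d -> probability X R) (P : probability Omega R).
Variables (W : nat -> nat -> {RV P >-> X}) (tau : nat -> nat) (lambda : R)
  (theta0 theta1 : 'cV[R]_d).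
Hypothesis hdata : changepoint_data Pr W tau theta0 theta1.
Hypothesis htau : (tau n)%:R / n%:R @[n --> \oo] --> lambda.

(** Joint independence is applied to the family equal to [A] at [i] and [j] and to the whole space
    elsewhere; all other factors are 1. *)
Lemma independent_sample_pair n i j (A : set X) : independent_sample W n ->
  (1 <= i <= n)%N -> (1 <= j <= n)%N -> i != j -> measurable A ->
  P (W n i @^-1` A `&` W n j @^-1` A) =
  (P (W n i @^-1` A) * P (W n j @^-1` A))%E.
Proof.
move=> indep i1n j1n ij mA.
pose F k : set X := if (k == i) || (k == j) then A else setT.
have mF k : measurable (F k) by rewrite /F; case: ifP.
have := indep F mF.
have -> : \bigcap_(k in [set k | (1 <= k <= n)%N]) (W n k @^-1` F k) =
    W n i @^-1` A `&` W n j @^-1` A.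
  apply/seteqP; split => w /=.
    by move=> h; split; [have := h i i1n|have := h j j1n];
      rewrite /F eqxx ?orbT.
  by move=> [hi hj] k _; rewrite /F; case: ifP => // /orP[]/eqP ->.
move=> ->; rewrite (bigD1_seq i) ?mem_index_iota ?iota_uniq//=.
rewrite -big_filter (bigD1_seq j) ?filter_uniq ?iota_uniq//=; last first.
  by rewrite mem_filter eq_sym ij mem_index_iota.
rewrite big_filter_cond big1 ?mule1; first by rewrite /F !eqxx orbT.
move=> k /andP[ki kj].
by rewrite /F (negbTE ki) (negbTE kj) preimage_setT probability_setT.
Qed.

Lemma pre_change_sample : \forall n \near \oo, ((tau n).+1 - 1 <= n)%N /\
  pairwise_sample (Pr theta0) (W n) 1 (tau n).+1.
Proof.
near=> n.
have n2 : (2 <= n)%N by near: n; exact: nbhs_infty_ge.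
have [/andP[t1 tn] indep pre _] := hdata n2.
have {}tn : (tau n <= n)%N by rewrite (leq_trans tn)// leq_pred.
split; first by rewrite subn1.
split=> [k kt A mA|j k jt kt jk A mA]; first exact: pre.
rewrite independent_sample_pair//.
- by congr (_ * _)%E; exact: pre.
- by case/andP: jt => -> /=; rewrite ltnS => /leq_trans; apply.
- by case/andP: kt => -> /=; rewrite ltnS => /leq_trans; apply.
Unshelve. all: by end_near. Qed.

Lemma post_change_sample : \forall n \near \oo, (n.+1 - (tau n).+1 <= n)%N /\
  pairwise_sample (Pr theta1) (W n) (tau n).+1 n.+1.
Proof.
near=> n.
have n2 : (2 <= n)%N by near: n; exact: nbhs_infty_ge.
have [/andP[t1 tn] indep _ post] := hdata n2.
split; first by rewrite subSS leq_subr.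
split=> [k kt A mA|j k jt kt jk A mA]; first exact: post.
rewrite independent_sample_pair//.
- by congr (_ * _)%E; exact: post.
- by case/andP: jt => jt; rewrite ltnS => ->; rewrite (leq_trans _ jt).
- by case/andP: kt => kt; rewrite ltnS => ->; rewrite (leq_trans _ kt).
Unshelve. all: by end_near. Qed.

Lemma pre_change_rate : ((tau n).+1 - 1)%:R / n%:R @[n --> \oo] --> lambda.
Proof. by under eq_cvg do rewrite subn1. Qed.

Lemma post_change_rate :
  (n.+1 - (tau n).+1)%:R / n%:R @[n --> \oo] --> 1 - lambda.
Proof.
apply: cvg_trans (cvgB (cvg_cst (1 : R)) htau); apply: near_eq_cvg; near=> n.
have n2 : (2 <= n)%N by near: n; exact: nbhs_infty_ge.
have n0 : n%:R != 0 :> R by rewrite pnatr_eq0 -lt0n (leq_trans _ n2).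
have [/andP[_ tn] _ _ _] := hdata n2.
rewrite subSS natrB; last by rewrite (leq_trans tn)// leq_pred.
by rewrite /= !fctE mulrBl divff.
Unshelve. all: by end_near. Qed.

End changepoint_sample.

(** * Limits of quadratic forms in inverse matrices *)

Section entrywise_limits.
Context {R : realType} {T : Type} {F : set_system T} {FF : Filter F}.

(** Working entrywise turns products, determinants and cofactors into sums and products of scalar
    limits. *)
Definition mxcvg {m n : nat} (M : T -> 'M[R]_(m, n)) (L : 'M[R]_(m, n)) :
    Prop :=
  forall i j, M x i j @[x --> F] --> L i j.

Lemma cvg_sumr (I : finType) (f : I -> T -> R) (l : I -> R) :
  (forall i, f i x @[x --> F] --> l i) ->
  \sum_i f i x @[x --> F] --> \sum_i l i.
Proof. by move=> h; apply: cvg_big => // ; exact: add_continuous. Qed.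

Lemma cvg_prodr (I : finType) (f : I -> T -> R) (l : I -> R) :
  (forall i, f i x @[x --> F] --> l i) ->
  \prod_i f i x @[x --> F] --> \prod_i l i.
Proof. by move=> h; apply: cvg_big => // ; exact: mul_continuous. Qed.

Lemma mxcvgM m n p (M : T -> 'M[R]_(m, n)) (N : T -> 'M[R]_(n, p)) L K :
  mxcvg M L -> mxcvg N K -> mxcvg (fun x => M x *m N x) (L *m K).
Proof.
move=> hM hN i j; under eq_cvg do rewrite mxE; rewrite mxE.
by apply: cvg_sumr => k; apply: cvgM; [exact: hM|exact: hN].
Qed.

Lemma mxcvgB m n (M N : T -> 'M[R]_(m, n)) L K :
  mxcvg M L -> mxcvg N K -> mxcvg (fun x => M x - N x) (L - K).
Proof.
move=> hM hN i j; under eq_cvg do rewrite !mxE; rewrite !mxE.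
by apply: cvgB; [exact: hM|exact: hN].
Qed.

Lemma mxcvg_tr m n (M : T -> 'M[R]_(m, n)) L :
  mxcvg M L -> mxcvg (fun x => (M x)^T) L^T.
Proof.
by move=> hM i j; under eq_cvg do rewrite mxE; rewrite mxE; exact: hM.
Qed.

Lemma mxcvg_sub m n m' n' (f : 'I_m' -> 'I_m) (g : 'I_n' -> 'I_n)
    (M : T -> 'M[R]_(m, n)) L :
  mxcvg M L -> mxcvg (fun x => mxsub f g (M x)) (mxsub f g L).
Proof.
by move=> hM i j; under eq_cvg do rewrite mxE; rewrite mxE; exact: hM.
Qed.

Lemma cvg_det n (M : T -> 'M[R]_n) L :
  mxcvg M L -> \det (M x) @[x --> F] --> \det L.
Proof.
move=> hM; apply: cvg_sumr => s; apply: cvgM; first exact: cvg_cst.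
by apply: cvg_prodr => i; exact: hM.
Qed.

Lemma near_unitmx n (M : T -> 'M[R]_n) L : mxcvg M L -> L \in unitmx ->
  \forall x \near F, M x \in unitmx.
Proof.
move=> /cvg_det hM; rewrite unitmxE unitfE => L0.
near=> x; rewrite unitmxE unitfE.
by near: x; exact: (hM _ (open_nbhs_nbhs (conj (@open_neq _ 0) L0))).
Unshelve. all: by end_near. Qed.

(** [invmx] is defined by cases. Since the determinant is eventually nonzero, the cofactor formula
    eventually applies, and it is continuous. *)
Lemma mxcvgV n (M : T -> 'M[R]_n) L : mxcvg M L -> L \in unitmx ->
  mxcvg (fun x => invmx (M x)) (invmx L).
Proof.
move=> hM uL i j; have uM := near_unitmx hM uL.
apply: (@cvg_trans _ ((\det (M x))^-1 * cofactor (M x) j i @[x --> F])).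
  by apply: near_eq_cvg; near=> x; rewrite /invmx (near uM x)// !mxE.
rewrite /invmx uL !mxE; apply: cvgM.
  by apply: cvgV; [move: uL; rewrite unitmxE unitfE|exact: cvg_det].
apply: cvgM; first exact: cvg_cst.
by apply: cvg_det => a b; under eq_cvg do rewrite !mxE; rewrite !mxE; exact: hM.
Unshelve. all: by end_near. Qed.

End entrywise_limits.

(** * Positive definite forms and lower bounds stable under perturbation *)

Section quadratic_forms.
Context {R : realType}.

(** Unlike [posdef], symmetry is left out, so it need not be tracked through profile informations
    and their submatrices. *)
Definition pdform {d} (A : 'M[R]_d) : Prop :=
  forall v : 'cV[R]_d, v != 0 -> 0 < (v^T *m A *m v) 0 0.

Lemma pdform_unit d (A : 'M[R]_d) : pdform A -> A \in unitmx.
Proof.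
move=> pA; rewrite unitmxE unitfE; apply/det0P => -[v v0 vA].
have := pA v^T; rewrite trmxK vA mul0mx mxE ltxx => h.
suff /h : v^T != 0 by [].
by rewrite -trmx0 (inj_eq (can_inj (@trmxK _ _ _))).
Qed.

Lemma pdformD d (A B : 'M[R]_d) : pdform A -> pdform B -> pdform (A + B).
Proof.
by move=> pA pB v v0; rewrite mulmxDr mulmxDl mxE addr_gt0 ?pA ?pB.
Qed.

Lemma pdformZ d (A : 'M[R]_d) a : 0 < a -> pdform A -> pdform (a *: A).
Proof.
by move=> a0 pA v v0; rewrite -scalemxAr -scalemxAl mxE mulr_gt0 ?pA.
Qed.

(** The submatrix is [J *m A *m J^T] for a selection matrix [J]. Injectivity of [f] gives
    [J *m J^T = 1], so [J^T *m v] vanishes only with [v]. *)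
Lemma pdform_mxsub d m (f : 'I_m -> 'I_d) (A : 'M[R]_d) :
  injective f -> pdform A -> pdform (mxsub f f A).
Proof.
move=> injf pA v v0; pose J : 'M[R]_(m, d) := rowsub f 1%:M.
have -> : mxsub f f A = J *m A *m J^T.
  by rewrite /J mul_rowsub_mx mul1mx trmx_mxsub trmx1 mulmx_colsub mulmx1;
    apply/matrixP => i j; rewrite !mxE.
have JJ : J *m J^T = 1%:M.
  rewrite /J trmx_mxsub trmx1 mul_rowsub_mx mul1mx.
  by apply/matrixP => i j; rewrite !mxE (inj_eq injf).
have Jv0 : J^T *m v != 0.
  by apply: contra v0 => /eqP h; rewrite -[v]mul1mx -JJ -mulmxA h mulmx0.
by have := pA _ Jv0; rewrite trmx_mul trmxK !mulmxA.
Qed.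

(** Writing [s = A *m u], the form of the inverse at [s] is the transpose of the form of [A] at
    [u]. *)
Lemma pdform_inv d (A : 'M[R]_d) (s : 'cV[R]_d) : pdform A -> s != 0 ->
  0 < (s^T *m invmx A *m s) 0 0.
Proof.
move=> pA s0; have uA := pdform_unit pA.
have [u uE] : exists u, invmx A *m s = u by eexists.
have sE : s = A *m u by rewrite -uE mulKVmx.
have u0 : u != 0 by apply: contra s0 => /eqP u0; rewrite sE u0 mulmx0.
have := pA _ u0.
have -> : s^T *m invmx A *m s = (u^T *m A *m u)^T.
  by rewrite !trmx_mul trmxK mulmxA -trmx_mul -sE -uE mulmxA.
by rewrite [X in _ -> 0 < X]mxE.
Qed.

(* With [u = (A + B)^-1 B v], the form of the Schur-type complement at [v] is
   [(v - u)^T B (v - u) + u^T A u]. *)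
Lemma pdform_parallel d (A B : 'M[R]_d) : A^T = A -> B^T = B ->
  pdform A -> pdform B -> pdform (B - B^T *m invmx (A + B) *m B).
Proof.
move=> sA sB pA pB v v0; have uAB := pdform_unit (pdformD pA pB).
pose u := invmx (A + B) *m (B *m v).
have AuB : A *m u = B *m (v - u).
  have : (A + B) *m u = B *m v by rewrite /u mulKVmx.
  by rewrite mulmxDl mulmxBr => <-; rewrite addrK.
have -> : v^T *m (B - B^T *m invmx (A + B) *m B) *m v =
    (v - u)^T *m B *m (v - u) + u^T *m A *m u.
  rewrite -[in RHS](mulmxA u^T) AuB.
  rewrite mulmxBr mulmxBl -!mulmxA -/u sB.
  rewrite linearB/= mulmxBl mulmxA subrK -mulmxA mulmxBr.
  by rewrite mulmxBr.
rewrite mxE.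
have [u0|u0] := eqVneq u 0.
  by rewrite u0 subr0 mulmx0 [X in _ + X]mxE addr0; exact: pB.
have [vu|vu] := eqVneq (v - u) 0.
  by rewrite vu mulmx0 [X in X + _]mxE add0r; exact: pA.
by rewrite addr_gt0// ?pA ?pB.
Qed.

(** With an inverse as middle factor, this is the homogeneity of degree one used both for the
    profile information and for the statistic built on it. *)
Lemma scale_quad m n p (a : R) (M : 'M[R]_(m, n)) (N : 'M[R]_m)
    (K : 'M[R]_(m, p)) : a != 0 ->
  (a *: M)^T *m (a^-1 *: N) *m (a *: K) = a *: (M^T *m N *m K).
Proof.
move=> a0; have -> : (a *: M)^T = a *: M^T.
  by apply/matrixP => i j; rewrite !mxE.
by rewrite -!scalemxAr -!scalemxAl !scalerA mulfV// mul1r.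
Qed.

(** The quadratic form is continuous at [(s, (B, A + B))] and positive there; [c] is half its value.
    Being deterministic, the bound applies at each sample with [a] the sample size, [s'] the score,
    [B'] the post-change information and [C'] the full one. *)
Lemma near_quad_gt d m (f : 'I_m -> 'I_d) (A B : 'M[R]_d) (s : 'cV[R]_d) :
  injective f -> posdef A -> posdef B -> rowsub f s != 0 ->
  exists c delta : R, [/\ 0 < c, 0 < delta &
    forall a (s' : 'cV[R]_d) (B' C' : 'M[R]_d), 0 < a ->
    (forall i, `|a^-1 * s' i 0 - s i 0| < delta) ->
    (forall i j, `|a^-1 * B' i j - B i j| < delta) ->
    (forall i j, `|a^-1 * C' i j - (A + B) i j| < delta) ->
    c * a <
      ((rowsub f s')^T *m invmx (mxsub f f (B' - B'^T *m invmx C' *m B'))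
        *m rowsub f s') 0 0].
Proof.
move=> injf [sA pA] [sB pB] s0.
set T : Type := ('cV[R]_d * ('M[R]_d * 'M[R]_d))%type.
pose V (z : T) := z.2.1 - z.2.1^T *m invmx z.2.2 *m z.2.1.
pose q (z : T) :=
  ((rowsub f z.1)^T *m invmx (mxsub f f (V z)) *m rowsub f z.1) 0 0.
pose z0 : T := (s, (B, A + B)).
have c1 : mxcvg (F := nbhs z0) (fun z => z.1) s.
  move=> i j.
  apply: (@cvg_comp _ _ _ fst (fun M : 'cV[R]_d => M i j) _ (nbhs s)).
    exact: cvg_fst.
  exact: coord_continuous.
have c2 : mxcvg (F := nbhs z0) (fun z => z.2.1) B.
  move=> i j; apply: (@cvg_comp _ _ _ (fun z : T => z.2.1)
      (fun M : 'M[R]_d => M i j) _ (nbhs B)); last exact: coord_continuous.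
  by apply: (@cvg_comp _ _ _ snd fst _ (nbhs (B, A + B)));
    [exact: cvg_snd|exact: cvg_fst].
have c3 : mxcvg (F := nbhs z0) (fun z => z.2.2) (A + B).
  move=> i j; apply: (@cvg_comp _ _ _ (fun z : T => z.2.2)
      (fun M : 'M[R]_d => M i j) _ (nbhs (A + B)));
    last exact: coord_continuous.
  by apply: (@cvg_comp _ _ _ snd snd _ (nbhs (B, A + B)));
    [exact: cvg_snd|exact: cvg_snd].
have uAB := pdform_unit (pdformD pA pB).
have pV := pdform_mxsub injf (pdform_parallel sA sB pA pB).
have cV : mxcvg (F := nbhs z0) (fun z => mxsub f f (V z)) (mxsub f f (V z0)).
  apply: mxcvg_sub; apply: mxcvgB => //.
  by do 2 apply: mxcvgM => //; [exact: mxcvg_tr|exact: mxcvgV].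
have cq : q z @[z --> z0] --> q z0.
  have cs : mxcvg (F := nbhs z0) (fun z : T => rowsub f z.1) (rowsub f s).
    exact: mxcvg_sub.
  exact: (mxcvgM (mxcvgM (mxcvg_tr cs) (mxcvgV cV (pdform_unit pV))) cs).
have q0 : 0 < q z0 by exact: pdform_inv.
(* Invertibility is kept for the rescaling: [invmx] fixes singular matrices, and there it would
   scale by [a] instead of [a^-1]. *)
have : \forall z \near z0, [/\ q z0 / 2 < q z, z.2.2 \in unitmx &
    mxsub f f (V z) \in unitmx].
  have h1 : \forall z \near z0, q z0 / 2 < q z.
    by apply: (cvgr_gt _ cq); rewrite ltr_pdivrMr// ltr_pMr// ltr1n.
  have h2 : \forall z \near z0, z.2.2 \in unitmx by exact: (near_unitmx c3 uAB).
  have h3 : \forall z \near z0, mxsub f f (V z) \in unitmx.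
    exact: (near_unitmx cV (pdform_unit pV)).
  by near=> z; split; near: z.
move=> /nbhs_ballP[delta /= delta0 hd].
exists (q z0 / 2), delta; split => //; first by rewrite divr_gt0.
move=> a S' B0 C0 a0; have an0 : a != 0 by rewrite gt_eqF.
have ua : a \is a GRing.unit by rewrite unitfE.
have aK k (M : 'M[R]_(d, k)) : exists2 N : 'M[R]_(d, k), M = a *: N &
    forall i j, a^-1 * M i j = N i j.
  by exists (a^-1 *: M) => [|i j]; rewrite ?scalerA ?divff ?scale1r ?mxE.
have [s' -> sE] := aK _ S'; have [B' -> BE] := aK _ B0.
have [C' -> CE] := aK _ C0 => hs hB hC.
have [qz uC uV] : [/\ q z0 / 2 < q (s', (B', C')), C' \in unitmx &
    mxsub f f (V (s', (B', C'))) \in unitmx].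
  apply: (hd (s', (B', C'))); split; [|split] => //=.
  - by split=> // i j; rewrite (ord1 j) -ball_normE/= distrC -sE.
  - by split=> // i j; rewrite -ball_normE/= distrC -BE.
  - by split=> // i j; rewrite -ball_normE/= distrC -CE.
have -> : a *: B' - (a *: B')^T *m invmx (a *: C') *m (a *: B') =
    a *: V (s', (B', C')).
  by rewrite invmxZ ?unitmxZ// scale_quad// scalerBr.
have -> : mxsub f f (a *: V (s', (B', C'))) = a *: mxsub f f (V (s', (B', C'))).
  by apply/matrixP => i j; rewrite !mxE.
have -> : rowsub f (a *: s') = a *: rowsub f s'.
  by apply/matrixP => i j; rewrite !mxE.
by rewrite invmxZ ?unitmxZ// scale_quad// mxE mulrC ltr_pM2l.
Unshelve. all: by end_near. Qed.

End quadratic_forms.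

(** * Perturbation of the score and of the information *)

Section mean_value.
Context {R : realType}.

Lemma mean_value_bound (g : R -> R) (h K : R) :
  (forall t, `|t| <= `|h| -> derivable g t 1 /\ `|'D_1 g t| <= K) ->
  `|g h - g 0| <= K * `|h|.
Proof.
move=> dg.
have mvt a b : a <= b -> (forall t, a <= t <= b -> `|t| <= `|h|) ->
    `|g b - g a| <= K * (b - a).
  move=> ab abh.
  have [||c] := @MVT_segment _ g (fun t => 'D_1 g t) a b ab.
  - move=> t; rewrite in_itv/= => /andP[/ltW at_ /ltW tb].
    have [|dgt _] := dg t; first by apply: abh; rewrite at_.
    exact/derivableP.
  - apply: derivable_within_continuous => t; rewrite in_itv/= => abt.
    by have [] := dg t (abh _ abt).
  move=> cab ->; rewrite normrM [`|b - a|]ger0_norm ?subr_ge0//.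
  rewrite ler_wpM2r ?subr_ge0//.
  by have [|//] := dg c; apply: abh; rewrite in_itv/= in cab.
have [h0|h0] := leP 0 h.
  rewrite [`|h|]ger0_norm// -[X in K * X]subr0; apply: mvt => // t /andP[t0 th].
  by rewrite !ger0_norm.
rewrite distrC [`|h|]ltr0_norm// -[X in K * X]sub0r.
apply: mvt; first exact: ltW.
by move=> t /andP[ht t0]; rewrite ler0_norm// ltr0_norm// lerN2.
Qed.

Context {d : nat}.
Implicit Types (f : 'cV[R]_d -> R) (c theta : 'cV[R]_d).

Lemma derive_line f (x v : 'cV[R]_d) (t : R) : derivable f (x + t *: v) v ->
  derivable (fun u : R => f (x + u *: v)) t 1 /\
  'D_1 (fun u : R => f (x + u *: v)) t = 'D_v f (x + t *: v).
Proof.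
have E : (fun h : R => h^-1 *:
      (((fun u : R => f (x + u *: v)) \o shift t) (h *: 1) - f (x + t *: v))) =
    (fun h : R => h^-1 *:
      ((f \o shift (x + t *: v)) (h *: v) - f (x + t *: v))).
  apply/funext => h /=; congr (_ *: (f _ - _)).
  by rewrite scalerDl addrCA /GRing.scale/= mulr1.
by rewrite /derivable /derive E.
Qed.

(** Only partial derivatives are available, with no continuity that would give a differential. Hence
    the coordinates are changed one at a time, each change being a one-variable mean value estimate;
    the path stays in the box, and the [d] steps cost [K * e] each. *)
Lemma box_lipschitz f c (r K : R) :
  (forall theta, (forall i, `|theta i 0 - c i 0| < r) -> forall i,
     derivable f theta (basis_vec R i) /\ `|partial i f theta| <= K) ->
  forall theta (e : R), (forall i, `|theta i 0 - c i 0| <= e) -> e < r ->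
  `|f theta - f c| <= d%:R * K * e.
Proof.
move=> df theta e the er.
pose path (k : nat) : 'cV[R]_d :=
  \col_i (if (i < k)%N then theta i 0 else c i 0).
have step (k : 'I_d) : `|f (path k.+1) - f (path k)| <= K * e.
  have e0 : 0 <= e by apply: le_trans (the k).
  set h := theta k 0 - c k 0.
  have pathS : path k.+1 = path k + h *: basis_vec R k.
    apply/matrixP => i j; rewrite (ord1 j) !mxE eqxx andbT ltnS.
    have [->|ik] := eqVneq i k.
      by rewrite leqnn ltnn mulr1 /h addrC subrK.
    have /negbTE nik : (i : nat) != k by [].
    by rewrite mulr0 addr0 leq_eqVlt nik.
  have line t : `|t| <= `|h| -> forall i,
      `|(path k + t *: basis_vec R k) i 0 - c i 0| < r.
    move=> th i; rewrite !mxE eqxx andbT.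
    have [->|ik] := eqVneq i k.
      rewrite ltnn mulr1 [_ + t]addrC addrK; apply: le_lt_trans er.
      exact: le_trans (the k).
    rewrite mulr0 addr0; case: ifP => _; first exact: le_lt_trans er.
    by rewrite subrr normr0; apply: le_lt_trans er.
  have : `|f (path k + h *: basis_vec R k) - f (path k + 0 *: basis_vec R k)|
      <= K * `|h|.
    apply: (mean_value_bound (g := fun t => f (path k + t *: basis_vec R k))).
    move=> t th; have [dft leK] := df _ (line t th) k.
    by have [? ->] := derive_line dft; split.
  rewrite pathS scale0r addr0 => /le_trans; apply.
  (* The bound on the partial derivative at the start of the segment shows that [K] is
     nonnegative. *)
  have h0 : `|0 : R| <= `|h| by rewrite normr0.
  have [_ leK] := df _ (line 0 h0) k.
  by apply: ler_wpM2l; [exact: le_trans (normr_ge0 _) leK|exact: the].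
have -> : f theta - f c = \sum_(k < d) (f (path k.+1) - f (path k)).
  rewrite -(big_mkord xpredT (fun k => f (path k.+1) - f (path k))).
  rewrite telescope_sumr//; congr (f _ - f _); apply/matrixP => i j.
    by rewrite (ord1 j) mxE ltn_ord.
  by rewrite (ord1 j) mxE ltn0.
apply: le_trans (ler_norm_sum _ _ _) _.
apply: (@le_trans _ _ (\sum_(k < d) K * e)); first by apply: ler_sum => k _.
by rewrite sumr_const card_ord -[leLHS]mulr_natl mulrA.
Qed.

Lemma derive_bigsum (I : eqType) (s : seq I) (F : I -> 'cV[R]_d -> R) x v :
  (forall k, k \in s -> derivable (F k) x v) ->
  derivable (fun t => \sum_(k <- s) F k t) x v /\
  'D_v (fun t => \sum_(k <- s) F k t) x = \sum_(k <- s) 'D_v (F k) x.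
Proof.
elim: s => [|k s ih] dF.
  have -> : (fun t => \sum_(k <- [::]) F k t) = cst 0.
    by apply/funext => t; rewrite big_nil.
  by split; [exact: derivable_cst|rewrite derive_cst big_nil].
have [|dS DS] := ih; first by move=> j js; apply: dF; rewrite inE js orbT.
have dk : derivable (F k) x v by apply: dF; rewrite inE eqxx.
have -> : (fun t => \sum_(k <- k :: s) F k t) =
    F k + (fun t => \sum_(k <- s) F k t).
  by apply/funext => t; rewrite big_cons fctE.
split; first exact: derivableD dk dS.
by rewrite (deriveD dk dS) DS big_cons.
Qed.

End mean_value.

(** * Deterministic Taylor bounds for the log-likelihood around [thetas] *)

Section loglik_expansion.
Context {R : realType} {d : nat} {dX : measure_display} {X : measurableType dX}.
Variables (p : 'cV[R]_d -> X -> R) (thetas : 'cV[R]_d) (r : R).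
Variable M : 'I_d -> 'I_d -> 'I_d -> X -> R.
Hypothesis r0 : 0 < r.

Definition box : set 'cV[R]_d := [set t | forall i, `|t i 0 - thetas i 0| < r].

Lemma near_box (theta : 'cV[R]_d) : box theta -> \forall t \near theta, box t.
Proof.
move=> bt.
have h (i : 'I_d) : \forall t \near theta,
      `|(t : 'cV[R]_d) i 0 - thetas i 0| < r.
  have cv : (t : 'cV[R]_d) i 0 - thetas i 0 @[t --> theta] -->
      theta i 0 - thetas i 0.
    have c1 : (fun t : 'cV[R]_d => t i 0) t @[t --> theta] --> theta i 0.
      exact: (@coord_continuous R d 1 i 0 theta).
    have c2 : (fun _ : 'cV[R]_d => thetas i 0) t @[t --> theta] --> thetas i 0.
      apply: (@cvg_cst _ _ _ (nbhs theta) (nbhs_filter theta)).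
    exact: (cvgB c1 c2).
  exact: (cvgr_lt _ (cvg_norm cv)).
exact: filter_forall h.
Qed.

(** The smoothness at one observation that A'2 provides almost surely, isolated so that the
    estimates below hold pointwise in the sample. *)
Definition regular_at (x : X) : Prop :=
  (forall theta, box theta -> forall j,
     derivable (ell p x) theta (basis_vec R j) /\
     forall i, derivable (partial j (ell p x)) theta (basis_vec R i)) /\
  (forall theta, box theta -> forall i j k,
     derivable (partial j (partial k (ell p x))) theta (basis_vec R i) /\
     `|partial i (partial j (partial k (ell p x))) theta| <= M i j k x).

Definition third_bound (x : X) : R := \sum_i \sum_j \sum_k M i j k x.

(** An envelope of the second partials on the whole box: their size at [thetas] plus the growth
    allowed by the third ones. A'4 makes the first part integrable and A'2 the second. *)
Definition second_bound (x : X) : R :=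
  \sum_i \sum_j `|partial i (partial j (ell p x)) thetas| +
  d%:R * third_bound x * r.

Lemma ler_sum2 (F : 'I_d -> 'I_d -> R) i j : (forall i j, 0 <= F i j) ->
  F i j <= \sum_i \sum_j F i j.
Proof.
move=> F0; rewrite (bigD1 i)//= (bigD1 j)//= -addrA lerDl addr_ge0// sumr_ge0//.
by move=> k _; rewrite sumr_ge0.
Qed.

Lemma le_third_bound x i j k : (forall i j k, 0 <= M i j k x) ->
  M i j k x <= third_bound x.
Proof.
move=> M0; rewrite /third_bound (bigD1 i)//= (bigD1 j)//= (bigD1 k)//=.
rewrite -!addrA lerDl !addr_ge0// ?sumr_ge0// => ? _;
  rewrite ?sumr_ge0// => ? _.
by rewrite sumr_ge0.
Qed.

Lemma regular_ge0 x : regular_at x -> forall i j k, 0 <= M i j k x.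
Proof.
move=> [_ h] i j k; have [|_] := h thetas _ i j k.
  by move=> ?; rewrite subrr normr0.
exact: le_trans.
Qed.

Lemma second_partial_lipschitz x (theta : 'cV[R]_d) (e : R) i j :
  regular_at x ->
  (forall i, `|theta i 0 - thetas i 0| <= e) -> e < r ->
  `|partial i (partial j (ell p x)) theta -
    partial i (partial j (ell p x)) thetas| <= d%:R * third_bound x * e.
Proof.
move=> rx the er; have M0 := regular_ge0 rx.
apply: (@box_lipschitz _ _ _ _ r) => // t bt k.
have [dk bk] := rx.2 t bt k i j; split=> //.
by apply: le_trans bk _; exact: le_third_bound.
Qed.

Lemma first_partial_lipschitz x (theta : 'cV[R]_d) (e : R) j : regular_at x ->
  (forall i, `|theta i 0 - thetas i 0| <= e) -> e < r ->
  `|partial j (ell p x) theta - partial j (ell p x) thetas|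
    <= d%:R * second_bound x * e.
Proof.
move=> rx the er; have M0 := regular_ge0 rx.
have T0 : 0 <= third_bound x.
  by rewrite !sumr_ge0// => ? _; rewrite sumr_ge0// => ? _; rewrite sumr_ge0.
apply: (@box_lipschitz _ _ _ _ r) => // t bt i.
have [_ /(_ i) di] := rx.1 t bt j; split=> //.
rewrite -[X in `|X|](subrK (partial i (partial j (ell p x)) thetas)) addrC.
apply: le_trans (ler_normD _ _) _; apply: lerD.
  exact: (ler_sum2 (F := fun i j => `|partial i (partial j (ell p x)) thetas|)).
(* The Lipschitz estimate wants a radius strictly below [r]; the actual distance of [t] qualifies,
   being a maximum of finitely many numbers below [r]. *)
pose e' := \big[Num.max/0]_k `|t k 0 - thetas k 0|.
apply: (@le_trans _ _ (d%:R * third_bound x * e')).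
  apply: second_partial_lipschitz => //.
    by move=> k; exact: le_bigmax.
  by apply/bigmax_ltP; split => // k _; exact: bt.
rewrite ler_wpM2l ?mulr_ge0//; apply/bigmax_leP; split; first exact: ltW.
by move=> k _; exact/ltW/bt.
Qed.

Variables (w : nat -> X) (a b : nat).
Hypothesis rw : forall k, (a <= k < b.+1)%N -> regular_at (w k).

Lemma partial_loglik theta j : box theta ->
  partial j (loglik p w a b) theta =
  \sum_(a <= k < b.+1) partial j (ell p (w k)) theta.
Proof.
move=> bt.
have [|_] := @derive_bigsum R d _ (index_iota a b.+1)
    (fun k => ell p (w k)) theta (basis_vec R j).
  move=> k; rewrite mem_index_iota => kab.
  by have [] := (rw kab).1 _ bt j.
by [].
Qed.

Lemma second_partial_loglik theta i j : box theta ->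
  partial i (partial j (loglik p w a b)) theta =
  \sum_(a <= k < b.+1) partial i (partial j (ell p (w k))) theta.
Proof.
move=> bt.
(* The termwise formula for the first partial holds on the box only; since the box is open, it holds
   near [theta], which suffices to differentiate again. *)
have -> : partial i (partial j (loglik p w a b)) theta =
    partial i (fun t => \sum_(a <= k < b.+1) partial j (ell p (w k)) t) theta.
  apply: near_eq_derive; have := near_box bt; apply: filterS => t.
  exact: partial_loglik.
have [|_] := @derive_bigsum R d _ (index_iota a b.+1)
    (fun k => partial j (ell p (w k))) theta (basis_vec R i).
  move=> k; rewrite mem_index_iota => kab.
  by have [_ ] := (rw kab).1 _ bt j.
by [].
Qed.

Lemma infoE theta i j : box theta -> info p w a b theta i j =
  - \sum_(a <= k < b.+1) partial i (partial j (ell p (w k))) theta.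
Proof. by move=> bt; rewrite !mxE second_partial_loglik. Qed.

Variables (theta : 'cV[R]_d) (e : R).
Hypothesis the : forall i, `|theta i 0 - thetas i 0| <= e.
Hypothesis er : e < r.

Let bt : box theta.
Proof. by move=> i; exact: le_lt_trans er. Qed.

Lemma score_perturbation j :
  `|score p w a b theta j 0 -
    \sum_(a <= k < b.+1) partial j (ell p (w k)) thetas| <=
  d%:R * e * \sum_(a <= k < b.+1) second_bound (w k).
Proof.
rewrite mxE partial_loglik// -sumrB; apply: le_trans (ler_norm_sum _ _ _) _.
rewrite mulr_sumr big_nat_cond [leRHS]big_nat_cond.
apply: ler_sum => k /andP[kab _]; rewrite mulrAC.
by apply: first_partial_lipschitz => //; exact: rw.
Qed.

Lemma info_perturbation i j :
  `|info p w a b theta i j +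
    \sum_(a <= k < b.+1) partial i (partial j (ell p (w k))) thetas| <=
  d%:R * e * \sum_(a <= k < b.+1) third_bound (w k).
Proof.
rewrite !mxE second_partial_loglik// addrC -[X in `|_ + X|]opprK opprK distrC.
rewrite -sumrB; apply: le_trans (ler_norm_sum _ _ _) _.
rewrite mulr_sumr big_nat_cond [leRHS]big_nat_cond.
apply: ler_sum => k /andP[kab _]; rewrite mulrAC.
by apply: second_partial_lipschitz => //; exact: rw.
Qed.

End loglik_expansion.

(** This splits the full information at the changepoint, so that its two parts can be compared with
    limits under two different laws. *)
Lemma info_cat {R : realType} {d : nat} {dX : measure_display}
    {X : measurableType dX} (p : 'cV[R]_d -> X -> R) (thetas : 'cV[R]_d) (r : R)
    (M : 'I_d -> 'I_d -> 'I_d -> X -> R) (w : nat -> X) (a b c : nat)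
    (theta : 'cV[R]_d) i j : (a <= b.+1)%N -> (b <= c)%N ->
  (forall k, (a <= k < b.+1)%N -> regular_at p thetas r M (w k)) ->
  (forall k, (b.+1 <= k < c.+1)%N -> regular_at p thetas r M (w k)) ->
  box thetas r theta ->
  info p w a c theta i j = info p w a b theta i j + info p w b.+1 c theta i j.
Proof.
move=> ab bc rab rbc bt.
have rac k : (a <= k < c.+1)%N -> regular_at p thetas r M (w k).
  move=> /andP[ak kc]; have [kb|kb] := leqP k b.
    by apply: rab; rewrite ak ltnS.
  by apply: rbc; rewrite kb.
apply: etrans (infoE rac i j bt) _.
apply: etrans (esym (congr2 +%R (infoE rab i j bt) (infoE rbc i j bt))).
by rewrite (big_cat_nat (n := b.+1))//= opprD.
Qed.

(** * Consistency in power *)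

Section power.
Context {R : realType} {d : nat} {dX : measure_display} {X : measurableType dX}.

Lemma abs_le_enorm (v : 'cV[R]_d) i : `|v i 0| <= enorm v.
Proof.
rewrite -sqrtr_sqr /enorm ler_sqrt ?sqr_ge0//; last first.
  by rewrite sumr_ge0// => j _; rewrite sqr_ge0.
by rewrite (bigD1 i)//= lerDl sumr_ge0// => j _; rewrite sqr_ge0.
Qed.

Lemma integrable_Rsum (Q : probability X R) (F : 'I_d -> X -> R) :
  (forall i, Q.-integrable setT (EFin \o F i)) ->
  Q.-integrable setT (EFin \o (fun x => \sum_i F i x)).
Proof.
move=> h; have -> : EFin \o (fun x => \sum_i F i x) =
    (fun x => \sum_i (EFin \o F i) x)%E.
  by apply/funext => x /=; rewrite sumEFin.
exact: integrable_sum.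
Qed.

Lemma posdefZ (A : 'M[R]_d) a : 0 < a -> posdef A -> posdef (a *: A).
Proof.
move=> a0 [sA pA]; split; last exact: pdformZ.
by rewrite -[in RHS]sA; apply/matrixP => i j; rewrite !mxE.
Qed.

Variables (Theta : set 'cV[R]_d) (p : 'cV[R]_d -> X -> R)
  (Pr : 'cV[R]_d -> probability X R).
Variables (dO : measure_display) (Omega : measurableType dO)
  (P : probability Omega R) (W : nat -> nat -> {RV P >-> X}).
Variables (tau : nat -> nat) (lambda : R) (theta0 theta1 thetas : 'cV[R]_d)
  (thetahat : nat -> Omega -> 'cV[R]_d).
Hypothesis hdata : changepoint_data Pr W tau theta0 theta1.
Hypothesis hlambda : 0 < lambda < 1.
Hypothesis htau : (tau n)%:R / n%:R @[n --> \oo] --> lambda.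
Hypothesis hA2 : condA2 Theta p Pr theta0 theta1 thetas.
Hypothesis hA3 : condA3 p Pr theta0 theta1 thetas.
Hypothesis hA4 : condA4 p Pr theta0 theta1 thetas.
Hypothesis hmle : forall e : R, 0 < e ->
  whp P (fun n => [set w | enorm (thetahat n w - thetas) < e]).

(** The norm on matrices is the sup norm, so a ball inside the neighbourhood of A'2 is a coordinate
    box. *)
Lemma condA2_regular : exists r M, [/\ 0 < r,
  forall th, [set theta0; theta1] th ->
    {ae Pr th, forall x, regular_at p thetas r M x} &
  forall th, [set theta0; theta1] th -> forall i j k,
    expect_finite Pr th (M i j k)].
Proof.
have [Th [M [oT Tt _ h]]] := hA2.
have [r /= r0 rT] : exists2 r : R, 0 < r & ball thetas r `<=` Th.
  by apply/nbhs_ballP; exact: open_nbhs_nbhs.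
have boxT : box thetas r `<=` Th.
  move=> t bt; apply: rT; split => // i j.
  by rewrite (ord1 j) -ball_normE/= distrC; exact: bt.
exists r, M; split => // th hth; have [h1 h2 h3] := h th hth; last exact: h3.
apply: filterS2 h1 h2 => x [_ C2] D3; split=> [t /boxT Tht j|t /boxT Tht i j k].
  have [_ /(_ j)[dj [_ hj]]] := C2 t Tht.
  by exact: (conj dj (fun i => (hj i).1)).
exact: D3.
Qed.

Lemma mean_neg_partial2 th i j (rho : R) :
  rho * Istar p Pr th thetas i j =
  rho * \int[Pr th]_x (- partial i (partial j (ell p x)) thetas).
Proof. by rewrite mxE. Qed.

(** Error budget: [delta / 4] for the averages at [thetas] and [delta / 4] for moving from [thetas]
    to the estimator. Each segment is then within [delta / 2], and the full information, a sum of
    two segments, within [delta]. *)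
Lemma whp_quad_gt m (f : 'I_m -> 'I_d) : injective f ->
  rowsub f (Sstar p Pr theta1 thetas) != 0 ->
  exists2 c : R, 0 < c & whp P (fun n => [set w | c * n%:R <
    ((rowsub f (score p (W n ^~ w) (tau n).+1 n (thetahat n w)))^T *m
     invmx (mxsub f f (info_cp p (W n ^~ w) n (tau n) (thetahat n w))) *m
     rowsub f (score p (W n ^~ w) (tau n).+1 n (thetahat n w))) 0 0]).
Proof.
have ge_sum3 (a b c : R) : 0 <= a -> 0 <= b -> 0 <= c ->
    [/\ a + 1 <= a + b + c + 2, b + 1 <= a + b + c + 2
      & c + 1 <= a + b + c + 2].
  by move=> *; split; lra.
have DE (A B : 'M[R]_d) i j : (A + B) i j = A i j + B i j by rewrite mxE.
have ZE a k (A : 'M[R]_(d, k)) i j : (a *: A) i j = a * A i j by rewrite mxE.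
move=> injf S0; have /andP[l0 l1] := hlambda.
have l10 : 0 < 1 - lambda by rewrite subr_gt0.
have T0 : [set theta0; theta1] theta0 by left.
have T1 : [set theta0; theta1] theta1 by right.
have [r [M [r0 reg intM]]] := condA2_regular.
have intS th : [set theta0; theta1] th -> forall j,
    (Pr th).-integrable setT (EFin \o (fun x => partial j (ell p x) thetas)).
  by move=> hth j; have [_ /(_ j)[]] := hA3 hth.
have intH th : [set theta0; theta1] th -> forall i j, (Pr th).-integrable setT
    (EFin \o (fun x => partial i (partial j (ell p x)) thetas)).
  by move=> hth i j; have [/(_ i j)] := hA4 hth.
have intNH th : [set theta0; theta1] th -> forall i j, (Pr th).-integrable setT
    (EFin \o (fun x => - partial i (partial j (ell p x)) thetas)).
  by move=> hth i j; have := integrableN (intH th hth i j).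
have int3 th : [set theta0; theta1] th ->
    (Pr th).-integrable setT (EFin \o third_bound M).
  by move=> hth; do 3 apply: integrable_Rsum => ?; exact: intM.
have int2 th : [set theta0; theta1] th ->
    (Pr th).-integrable setT (EFin \o second_bound p thetas r M).
  move=> hth.
  pose F x := \sum_i \sum_j `|partial i (partial j (ell p x)) thetas|.
  have intF : (Pr th).-integrable setT (EFin \o F).
    do 2 apply: integrable_Rsum => ?.
    by have := integrable_abse (intH th hth _ _); exact.
  have := integrableD measurableT intF
    (integrableZl measurableT (d%:R * r) (int3 th hth)).
  apply: eq_integrable => // x _ /=.
  by rewrite -EFinM -EFinD /second_bound mulrAC.
have pA := posdefZ l0 (hA4 T0).2; have pB := posdefZ l10 (hA4 T1).2.
set S := Sstar p Pr theta1 thetas in S0 *.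
have s0 : rowsub f ((1 - lambda) *: S) != 0.
  have -> : rowsub f ((1 - lambda) *: S) = (1 - lambda) *: rowsub f S.
    by apply/matrixP => i j; rewrite !mxE.
  by rewrite scaler_eq0 negb_or gt_eqF.
have [c [delta [c0 delta0 hq]]] := near_quad_gt injf pA pB s0.
exists c => //.
have pre := pre_change_sample hdata; have preR := pre_change_rate htau.
have post := post_change_sample hdata.
have postR := post_change_rate hdata htau.
have d40 : 0 < delta / 4 by rewrite divr_gt0.
(* [K] eventually bounds the three averaged envelopes: each is within 1 of its limit with high
   probability. *)
pose K : R := `|(1 - lambda) * \int[Pr theta1]_x second_bound p thetas r M x| +
  `|(1 - lambda) * \int[Pr theta1]_x third_bound M x| +
  `|lambda * \int[Pr theta0]_x third_bound M x| + 2.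
have K0 : 0 < K by rewrite ltr_wpDl// !addr_ge0.
have dK0 : 0 < d%:R * K + 1 by rewrite ltr_wpDl// mulr_ge0// ltW.
(* The first term keeps the estimator strictly inside the box, the second makes the perturbation
   [d * e * K] smaller than [delta / 4]. *)
pose e := Num.min (r / 2) (delta / 4 / (d%:R * K + 1)).
have e0 : 0 < e by rewrite /e lt_min !divr_gt0.
have er : e < r.
  by rewrite /e gt_min ltr_pdivrMr// ltr_pMr// ltr1n.
have eK : d%:R * e * K < delta / 4.
  apply: (@le_lt_trans _ _ (d%:R * K * (delta / 4 / (d%:R * K + 1)))).
    rewrite mulrAC ler_wpM2l ?mulr_ge0 ?(ltW K0)//.
    by rewrite /e ge_min lexx orbT.
  by rewrite mulrA ltr_pdivrMr// mulrC ltr_pM2l// ltrDl.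
have w1 := hmle e0.
have w2 := whp_ae pre (reg _ T0).
have w3 := whp_ae post (reg _ T1).
have w4 := whp_mean post postR (int2 _ T1) ltr01.
have w5 := whp_mean post postR (int3 _ T1) ltr01.
have w6 := whp_mean pre preR (int3 _ T0) ltr01.
have w7 := whp_forall (fun j => whp_mean post postR (intS _ T1 j) d40).
have w8 := whp_forall (fun ij : 'I_d * 'I_d =>
  whp_mean post postR (intNH _ T1 ij.1 ij.2) d40).
have w9 := whp_forall (fun ij : 'I_d * 'I_d =>
  whp_mean pre preR (intNH _ T0 ij.1 ij.2) d40).
have := whpI (whpI (whpI w1 w2) (whpI w3 w4))
  (whpI (whpI w5 w6) (whpI w7 (whpI w8 w9))).
apply: whpS; near=> n.
have n2 : (2 <= n)%N by near: n; exact: nbhs_infty_ge.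
have n0 : (0 : R) < n%:R by rewrite ltr0n (leq_trans _ n2).
have nn0 : n%:R != 0 :> R by rewrite gt_eqF.
have [/andP[t1 tn] _ _ _] := hdata n2.
have {}tn : (tau n <= n)%N by rewrite (leq_trans tn)// leq_pred.
move=> w [[[/= v1 v2] [v3 v4]] [[v5 v6] [v7 [v8 v9]]]].
set x := (fun k => W n k w) in v2 v3 v4 v5 v6 v7 v8 v9 *.
set th := thetahat n w in v1 *.
have the i : `|th i 0 - thetas i 0| <= e.
  have := abs_le_enorm (th - thetas) i; rewrite !mxE => /le_trans; apply.
  exact: ltW.
have avg_le (y l k : R) : `|n%:R^-1 * y - l| < 1 -> `|l| + 1 <= k ->
    n%:R^-1 * y <= k.
  move=> h hk; apply: le_trans hk; have := ler_norm l.
  by move: h; rewrite ltr_norml => /andP[_]; lra.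
have bound (z y g l : R) : `|z - y| <= d%:R * e * g -> n%:R^-1 * g <= K ->
    `|n%:R^-1 * y - l| < delta / 4 -> `|n%:R^-1 * z - l| < delta / 2.
  move=> zy gK yl.
  have -> : n%:R^-1 * z - l = n%:R^-1 * (z - y) + (n%:R^-1 * y - l) by ring.
  have -> : delta / 2 = delta / 4 + delta / 4 by field.
  apply: le_lt_trans (ler_normD _ _) _; apply: ltr_leD _ (ltW yl).
  rewrite normrM gtr0_norm ?invr_gt0//; apply: le_lt_trans eK.
  apply: (@le_trans _ _ (n%:R^-1 * (d%:R * e * g))).
    by rewrite ler_wpM2l// invr_ge0 ltW.
  by rewrite mulrCA ler_wpM2l// mulr_ge0// ltW.
have [K31 K32 K33] : [/\ _ <= K, _ <= K & _ <= K] :=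
  ge_sum3 _ _ _ (normr_ge0 _) (normr_ge0 _) (normr_ge0 _).
have delta2 : delta / 2 < delta by rewrite ltr_pdivrMr// ltr_pMr// ltr1n.
have hs j : `|n%:R^-1 * score p x (tau n).+1 n th j 0 -
    ((1 - lambda) *: S) j 0| < delta.
  have SE : S j 0 = \int[Pr theta1]_x partial j (ell p x) thetas by rewrite mxE.
  rewrite ZE SE.
  apply: lt_trans delta2.
  apply: bound (score_perturbation r0 v3 the er j) _ (v7 j).
  exact: avg_le v4 K31.
have hpost i j : `|n%:R^-1 * info p x (tau n).+1 n th i j -
    (1 - lambda) * Istar p Pr theta1 thetas i j| < delta / 2.
  rewrite mean_neg_partial2.
  have := info_perturbation r0 v3 the er i j; rewrite -[X in `|_ + X|]opprK.
  rewrite -sumrN => /bound; apply; last exact: (v8 (i, j)).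
  exact: avg_le v5 K32.
have hpre i j : `|n%:R^-1 * info p x 1 (tau n) th i j -
    lambda * Istar p Pr theta0 thetas i j| < delta / 2.
  rewrite mean_neg_partial2.
  have := info_perturbation r0 v2 the er i j; rewrite -[X in `|_ + X|]opprK.
  rewrite -sumrN => /bound; apply; last exact: (v9 (i, j)).
  exact: avg_le v6 K33.
have hB i j : `|n%:R^-1 * info p x (tau n).+1 n th i j -
    ((1 - lambda) *: Istar p Pr theta1 thetas) i j| < delta.
  rewrite ZE.
  exact: lt_trans (hpost i j) delta2.
have hC i j : `|n%:R^-1 * info p x 1 n th i j -
    (lambda *: Istar p Pr theta0 thetas +
     (1 - lambda) *: Istar p Pr theta1 thetas) i j| < delta.
  have bth : box thetas r th by move=> k; exact: le_lt_trans (the k) er.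
  have infoD := info_cat i j (ltn0Sn (tau n)) tn v2 v3 bth.
  rewrite DE !ZE infoD.
  rewrite mulrDr opprD addrACA [delta]splitr.
  apply: le_lt_trans (ler_normD _ _) _.
  by apply: ltrD; [exact: hpre|exact: hpost].
exact: hq n0 hs hB hC.
Unshelve. all: by end_near. Qed.

Lemma psi_lin_power (alpha : R) : 0 < alpha ->
  Sstar p Pr theta1 thetas <> 0 -> (0 < d)%N ->
  whp P (fun n => [set w | psi_lin p (W n ^~ w) n (thetahat n w) alpha]).
Proof.
move=> a0 S0 d0.
have idE k (v : 'M[R]_(d, k)) : rowsub id v = v.
  by apply/matrixP => i j; rewrite mxE.
have [|c c0 hc] := @whp_quad_gt d id (fun _ _ => id).
  by rewrite idE; exact/eqP.
apply: whpS hc; near=> n => w /=; rewrite !idE => hc.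
have n2 : (2 <= n)%N by near: n; exact: nbhs_infty_ge.
have [/andP[t1 tn] _ _ _] := hdata n2.
have /andP[_ hH] : 0 < upper_quantile (@chi2 R d) (alpha / n%:R) < c * n%:R.
  by near: n; exact: upper_quantile_chi2_near.
rewrite /psi_lin a0/=.
apply: (@lt_le_trans _ _ (Rstat p (W n ^~ w) n (tau n) (thetahat n w))%:E).
  by rewrite lte_fin; exact: lt_trans hH hc.
apply: (le_bigmax_seq _ (tau n)) => //.
by rewrite mem_index_iota t1/= (leq_ltn_trans tn)// ltn_predL (leq_trans _ n2).
Unshelve. all: by end_near. Qed.

(** One term of the scan suffices: the true changepoint with the singleton of a coordinate where
    [S_1^*] is nonzero. *)
Lemma psi_scan_power (alpha : R) (pmax : nat) : 0 < alpha ->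
  Sstar p Pr theta1 thetas <> 0 -> (1 <= pmax)%N ->
  whp P (fun n => [set w | psi_scan p (W n ^~ w) pmax n (thetahat n w) alpha]).
Proof.
move=> a0 S0 pm.
have [i Si] : exists i, Sstar p Pr theta1 thetas i 0 != 0.
  apply: contra_notP S0 => /forallNP h; apply/matrixP => i j.
  by rewrite (ord1 j) [RHS]mxE; apply/eqP/negPn/negP/h.
have d0 : (0 < d)%N by exact: leq_ltn_trans (leq0n i) (ltn_ord i).
(* For subsets of size 1 the level is [alpha / (d * n * (1 + 1) ^ 2)], that is [b / n]. *)
pose b := alpha / (d%:R * 2 ^+ 2).
have b0 : 0 < b by rewrite divr_gt0// mulr_gt0// ?ltr0n.
pose T : {set 'I_d} := finset.set1 i.
have cT : #|T| = 1%N by rewrite cards1.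
have iT : i \in T by rewrite finset.in_set1.
pose f (k : 'I_#|T|) : 'I_d := enum_val k.
have [||c c0 hc] := @whp_quad_gt #|T| f.
- exact: enum_val_inj.
- apply: contra Si => /eqP/matrixP/(_ (enum_rank_in iT i) 0).
  by rewrite [RHS]mxE mxE /f enum_rankK_in// => ->.
apply: whpS hc; near=> n => w /= hc.
have n2 : (2 <= n)%N by near: n; exact: nbhs_infty_ge.
have [/andP[t1 tn] _ _ _] := hdata n2.
have /andP[H0 hH] : 0 < upper_quantile (@chi2 R 1) (b / n%:R) < c * n%:R.
  by near: n; exact: upper_quantile_chi2_near.
have HE : Hscan d n 1 alpha = upper_quantile (@chi2 R 1) (b / n%:R).
  rewrite /Hscan bin1; congr upper_quantile; rewrite /b.
  by field; rewrite !pnatr_eq0 -!lt0n d0 (leq_trans _ n2).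
rewrite /psi_scan a0/=.
apply: (@lt_le_trans _ _
    ((Hscan d n 1 alpha)^-1 *
       RstatT p (W n ^~ w) n (tau n) T (thetahat n w))%:E).
  by rewrite lte_fin HE ltr_pdivlMl// mulr1; exact: lt_trans hH hc.
apply: (bigmax_sup_seq _ (tau n)) => //.
  rewrite mem_index_iota t1/= (leq_ltn_trans tn)//.
  by rewrite ltn_predL (leq_trans _ n2).
apply: (bigmax_sup_seq _ 1%N) => //; first by rewrite mem_index_iota.
by apply: (bigmax_sup T) => //; rewrite cT.
Unshelve. all: by end_near. Qed.

End power.

Theorem corollary2
  (R : realType) (d : nat)
  (dX : measure_display) (X : measurableType dX)
  (mu : {measure set X -> \bar R})
  (Theta : set 'cV[R]_d) (p : 'cV[R]_d -> X -> R)
  (Pr : 'cV[R]_d -> probability X R)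
  (dO : measure_display) (Omega : measurableType dO) (P : probability Omega R)
  (W : nat -> nat -> {RV P >-> X})
  (tau : nat -> nat) (lambda : R) (theta0 theta1 thetas : 'cV[R]_d)
  (thetahat : nat -> Omega -> 'cV[R]_d) (pmax : nat)
  (hfam : density_family mu Theta p Pr)
  (htheta0 : Theta theta0) (htheta1 : Theta theta1)
  (hneq : theta0 <> theta1)
  (hdata : changepoint_data Pr W tau theta0 theta1)
  (hlambda : 0 < lambda < 1)
  (htau : (tau n)%:R / n%:R @[n --> \oo] --> lambda)
  (hA1 : condA1 mu Theta p lambda theta0 theta1 thetas)
  (hA2 : condA2 Theta p Pr theta0 theta1 thetas)
  (hA3 : condA3 p Pr theta0 theta1 thetas)
  (hA4 : condA4 p Pr theta0 theta1 thetas)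
  (hS1 : Sstar p Pr theta1 thetas <> 0)
  (hmle : mle_sequence Theta p W thetas thetahat)
  (hpmax : (1 <= pmax <= d)%N)
  (alpha : R) (halpha : 0 < alpha < 1) :
  (inner_prob P [set w | psi_lin p (fun k => W n k w) n (thetahat n w) alpha]
     @[n --> \oo] --> 1%E) /\
  (inner_prob P [set w | psi_scan p (fun k => W n k w) pmax n (thetahat n w)
                           alpha]
     @[n --> \oo] --> 1%E) /\
  (forall alphal alphas : R, 0 <= alphal -> 0 <= alphas ->
     alphal + alphas = alpha ->
     inner_prob P [set w | psi_auto p (fun k => W n k w) pmax n (thetahat n w)
                             alphal alphas]
       @[n --> \oo] --> 1%E).
Proof.
have /andP[pm pd] := hpmax.
have d0 : (0 < d)%N by exact: leq_trans pm pd.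
have hhat : forall e : R, 0 < e ->
    whp P (fun n => [set w | enorm (thetahat n w - thetas) < e]).
  exact: hmle.2.
have lin a : 0 < a ->
    whp P (fun n => [set w | psi_lin p (W n ^~ w) n (thetahat n w) a]).
  by move=> a0; exact: (psi_lin_power hdata hlambda htau hA2 hA3 hA4 hhat).
have scan a : 0 < a ->
    whp P (fun n => [set w | psi_scan p (W n ^~ w) pmax n (thetahat n w) a]).
  by move=> a0; exact: (psi_scan_power hdata hlambda htau hA2 hA3 hA4 hhat).
have /andP[a0 _] := halpha.
split; [exact: lin|split; [exact: scan|]] => al as_ al0 as0 asum.
(* The combined test rejects as soon as one component does. If the linear level is not positive, the
   sum condition makes the scan level positive. *)
have [l0|l0] := ltP 0 al.
  apply: whpS (lin _ l0); apply: nearW => n w hw /=.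
  by rewrite /psi_auto hw.
have s0 : 0 < as_ by lra.
apply: whpS (scan _ s0); apply: nearW => n w hw /=.
by rewrite /psi_auto hw orbT.
Qed.
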